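(* Let $f: X \rightarrow Y$ be a coarse map between proper metric spaces. Then $f$ is coarsely monotone if and only if the induced continuous map $\nu f: \nu X \rightarrow \nu Y$ between Higson coronas is (classically) monotone.
   Context: A metric space is proper if its closed bounded subsets are compact. A metric space $X$ is regarded as a large scale space (ls-space) in which a family $\mathcal{U}$ of subsets is uniformly bounded iff there is $M>0$ with $\mathrm{diam}(U)\le M$ for all $U\in\mathcal{U}$. More generally, an ls-structure on a set $X$ is a nonempty set $\mathcal{L}$ of families of subsets (the uniformly bounded families) such that (1) if $\mathcal{B}_1\in\mathcal{L}$ and each element of $\mathcal{B}_2$ with more than one point lies in an element of $\mathcal{B}_1$, then $\mathcal{B}_2\in\mathcal{L}$; (2) $\mathcal{B}_1,\mathcal{B}_2\in\mathcal{L}$ implies $\{\mathrm{st}(B,\mathcal{B}_2)\mid B\in\mathcal{B}_1\}\in\mathcal{L}$, where $\mathrm{st}(B,\mathcal{U})$ is the union of the elements of $\mathcal{U}$ meeting $B$. A map is ls-continuous if it sends uniformly bounded families to uniformly bounded families; two maps $f,g:X\to Y$ are close if $\{\{f(x),g(x)\}\mid x\in X\}$ is uniformly bounded; a coarse equivalence is an ls-continuous map with an ls-continuous inverse up to closeness. A coarse map is an ls-continuous map such that the inverse image of every bounded set is bounded. For a family $\mathcal{U}$ of subsets of $X$ and $A\subseteq X$, the $\mathcal{U}$-components of $A$ are the equivalence classes of the relation on $A$: $x,x'$ are joined by a finite sequence $x=x_1,\dots,x_k=x'$ in $A$ with each pair $x_i,x_{i+1}$ in a common element of $\mathcal{U}$.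 For ls-continuous $f:X\to Y$ and uniformly bounded $\mathcal{U}$ in $X$, $\mathcal{V}$ in $Y$, $c(\mathcal{U},f,\mathcal{V})$ is the family of all $\mathcal{U}$-components of sets $f^{-1}(V)$, $V\in\mathcal{V}$. The light structure on $X$ with respect to $f$ is the closure under refinement of the set of all $c(\mathcal{U},f,\mathcal{V})$ (all families each of whose elements with more than one point is contained in an element of one fixed $c(\mathcal{U},f,\mathcal{V})$); it is an ls-structure. $X_f$ denotes the set $X$ with this structure. The map $f$ is coarsely monotone if $f$, regarded as a map $X_f\to Y$, is a coarse equivalence. A bounded function $g:X\to\mathbb{C}$ on a metric space is slowly oscillating if for all $R,\varepsilon>0$ there is a bounded $B\subseteq X$ such that $d(x,x')\le R\Rightarrow |g(x)-g(x')|\le\varepsilon$ for $x,x'\in X\setminus B$. $B_h(X)$ is the $C^*$-algebra of (not necessarily continuous) bounded slowly oscillating functions $X\to\mathbb{C}$ and $B_0(X)$ its ideal of functions tending to $0$ at infinity (for every $\varepsilon>0$, $|g|\le\varepsilon$ outside a bounded set). The Higson corona $\nu X$ of a proper metric space $X$ is the compact Hausdorff space corresponding under Gelfand duality to $B_h(X)/B_0(X)$ (equivalently, $\nu X=hX\setminus X$, with $hX$ the compactification of $X$ to which exactly the continuous bounded slowly oscillating functions extend). A coarse map $f:X\to Y$ induces the $*$-homomorphism $[g]\mapsto[gf]$ from $B_h(Y)/B_0(Y)$ to $B_h(X)/B_0(X)$, which is dual to the continuous map $\nu f:\nu X\to\nu Y$. A continuous map between compact Hausdorff spaces is (classically) monotone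 if it is surjective and each of its fibres is connected. *)

(* Defs.v *)
From HB Require Import structures.
From mathcomp Require Import all_boot all_order all_algebra.
From mathcomp Require Import generic_quotient ring_quotient.
From mathcomp Require Import all_classical all_reals all_analysis.
From mathcomp Require Import complex.

Set Implicit Arguments.
Unset Strict Implicit.
Unset Printing Implicit Defensive.

Import Order.TTheory GRing.Theory Num.Theory.
Import numFieldNormedType.Exports.

Local Open Scope classical_set_scope.
Local Open Scope ring_scope.
Local Open Scope complex_scope.
Local Open Scope quotient_scope.

Definition family (X : Type) := set (set X).

(* Members of [F] with at most one point need not be covered. *)
Definition refines (X : Type) (F G : family X) :=
  forall B, F B -> (exists x y, [/\ B x, B y & x <> y]) ->
  exists2 C, G C & B `<=` C.

Definition star (X : Type) (B : set X) (U : family X) : set X :=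
  \bigcup_(A in [set A | U A /\ A `&` B !=set0]) A.

Record ls_structure (X : Type) := LsStructure {
  ls_bounded :> family X -> Prop;
  ls_nonempty : exists F, ls_bounded F;
  ls_refines : forall F G,
    ls_bounded G -> refines F G -> ls_bounded F;
  ls_star : forall F G,
    ls_bounded F -> ls_bounded G -> ls_bounded [set star B G | B in F] }.

Definition ls_continuous (X Y : Type) (LX : ls_structure X)
    (LY : ls_structure Y) (f : X -> Y) :=
  forall U, LX U -> LY [set f @` B | B in U].

Definition ls_close (X Y : Type) (LY : ls_structure Y) (f g : X -> Y) :=
  LY [set [set f x; g x] | x in [set: X]].

Definition coarse_equivalence (X Y : Type) (LX : ls_structure X)
    (LY : ls_structure Y) (f : X -> Y) :=
  ls_continuous LX LY f /\
  exists g : Y -> X, [/\ ls_continuous LY LX g,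
    ls_close LX (g \o f) id & ls_close LY (f \o g) id].

Definition chained (X : Type) (U : family X) (A : set X) (x x' : X) :=
  exists n (s : nat -> X), [/\ s 0%N = x, s n = x',
    (forall i, (i <= n)%N -> A (s i)) &
    forall i, (i < n)%N -> exists2 W, U W & W (s i) /\ W (s i.+1)].

Definition components (X : Type) (U : family X) (A : set X) : family X :=
  [set [set x' | chained U A x x'] | x in A].

Definition fiber_components (X Y : Type) (U : family X) (f : X -> Y)
    (V : family Y) : family X :=
  \bigcup_(B in V) components U (f @^-1` B).

Definition light_bounded (X Y : Type) (LX : ls_structure X)
    (LY : ls_structure Y) (f : X -> Y) : set (family X) :=
  [set F | exists U V, [/\ LX U, LY V & refines F (fiber_components U f V)]].

Section light_structure.
Variables (X Y : Type).

Definition singletons : family X := [set [set x] | x in [set: X]].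

Lemma refines_refl (F : family X) : refines F F.
Proof. by move=> B FB _; exists B. Qed.

Lemma singletonsU_bounded (L : ls_structure X) (F : family X) :
  L F -> L (F `|` singletons).
Proof.
move=> LF; apply: (ls_refines LF) => B [FB _|[x _ <-] [y [z [/= -> ->]]]] //.
by exists B.
Qed.

Lemma setU_bounded (L : ls_structure X) (F G : family X) :
  L F -> L G -> L (F `|` G).
Proof.
move=> /singletonsU_bounded LF /singletonsU_bounded LG.
apply: (ls_refines (ls_star LF LG)) => B [FB|GB] [x [y [Bx By _]]].
  exists (star B (G `|` singletons)); first by exists B => //; left.
  move=> z Bz; exists [set z] => //; split; first by right; exists z.
  by exists z.
exists (star [set x] (G `|` singletons)).
  by exists [set x] => //; right; exists x.
by move=> z Bz; exists B => //; split; [left|exists x].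
Qed.

Lemma chained_sub (U U' : family X) (A A' : set X) x y :
  U `<=` U' -> A `<=` A' -> chained U A x y -> chained U' A' x y.
Proof.
move=> UU' AA' [n [s [s0 sn sA sU]]]; exists n, s; split => // i il.
  exact/AA'/sA.
by have [W /UU' ? ?] := sU i il; exists W.
Qed.

Lemma chained_refl (U : family X) (A : set X) x : A x -> chained U A x x.
Proof. by move=> Ax; exists 0%N, (fun=> x); split. Qed.

Lemma chained_sym (U : family X) (A : set X) x y :
  chained U A x y -> chained U A y x.
Proof.
move=> [n [s [s0 sn sA sU]]]; exists n, (fun i => s (n - i)%N); split => //.
- by rewrite subn0.
- by rewrite subnn.
- by move=> i _; apply: sA; rewrite leq_subr.
- move=> i il; have [|W UW] := sU (n - i.+1)%N.
    by rewrite ltn_subrL (leq_ltn_trans _ il).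
  by rewrite -subSn // subSS => -[]; exists W.
Qed.

Lemma chained_trans (U : family X) (A : set X) x y z :
  chained U A x y -> chained U A y z -> chained U A x z.
Proof.
move=> [n [s [s0 sn sA sU]]] [m [t [t0 tm tA tU]]].
exists (n + m)%N, (fun i => if (i <= n)%N then s i else t (i - n)%N); split.
- by rewrite leq0n.
- case: ifPn => [|_]; last by rewrite addKn.
  rewrite -{2}[n]addn0 leq_add2l leqn0 => /eqP m0.
  by rewrite m0 addn0 sn -tm m0 t0.
- move=> i il; case: ifPn => [/sA//|]; rewrite -ltnNge => ni.
  by apply: tA; rewrite leq_subLR.
- move=> i il; have [ni|ni] := leqP i.+1 n.
    by rewrite (ltnW ni); exact: sU.
  have [|W UW Wt] := tU (i - n)%N; first by rewrite ltn_subLR.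
  exists W => //; rewrite subSn //; case: ifPn => // ni'.
  have -> : i = n by apply/eqP; rewrite eqn_leq ni' -ltnS.
  by move: Wt; rewrite (_ : i = n) ?subnn ?t0 ?sn //; apply/eqP;
    rewrite eqn_leq ni' -ltnS.
Qed.

Lemma chained_in (U : family X) (A : set X) x y :
  chained U A x y -> A x /\ A y.
Proof. by move=> [n [s [<- <- sA _]]]; split; exact: sA. Qed.

Variables (LX : ls_structure X) (LY : ls_structure Y) (f : X -> Y).

Lemma light_nonempty : light_bounded LX LY f !=set0.
Proof.
have [U LU] := ls_nonempty LX; have [V LV] := ls_nonempty LY.
by exists (fiber_components U f V), U, V; split => //; exact: refines_refl.
Qed.

Lemma light_refines F G :
  light_bounded LX LY f G -> refines F G -> light_bounded LX LY f F.
Proof.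
move=> [U [V [LU LV GUV]]] FG; exists U, V; split => // B FB Bxy.
have [C GC BC] := FG B FB Bxy; have [|D ? CD] := GUV C GC.
  by case: Bxy => x [y [/BC ? /BC ? ?]]; exists x, y.
by exists D => //; exact: subset_trans CD.
Qed.

End light_structure.

Section light_star.
Variables (X Y : Type) (LX : ls_structure X) (LY : ls_structure Y).
Variable f : X -> Y.

Lemma light_star F G : light_bounded LX LY f F -> light_bounded LX LY f G ->
  light_bounded LX LY f [set star B G | B in F].
Proof.
move=> [U1 [V1 [LU1 LV1 FUV]]] [U2 [V2 [LU2 LV2 GUV]]].
pose S2 := V2 `|` @singletons Y.
exists (U1 `|` U2), [set star B S2 | B in V1 `|` @singletons Y]; split.
- exact: setU_bounded.
- by apply: ls_star; exact: singletonsU_bounded.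
move=> _ [B FB <-] [z0 [_ [[A0 [_ [b0 [_ Bb0]] _]] _ _]]].
have [V V1V [x0 Bx0]] : exists2 V, (V1 `|` @singletons Y) V &
    exists x0, forall b, B b -> chained U1 (f @^-1` V) x0 b.
  have [Bnt|Bt] := pselect (exists x y, [/\ B x, B y & x <> y]).
    have [C [V V1V [x0 _ <-]] BC] := FUV B FB Bnt.
    by exists V; [left|exists x0].
  exists [set f b0]; first by right; exists (f b0).
  exists b0 => b Bb; have [<-|bb0] := pselect (b0 = b).
    exact: chained_refl.
  by exfalso; apply: Bt; exists b0, b.
have [Vx0 _] := chained_in (Bx0 _ Bb0).
have VW : V `<=` star V S2.
  by move=> y Vy; exists [set y] => //; split; [right; exists y|exists y].
exists [set x | chained (U1 `|` U2) (f @^-1` star V S2) x0 x].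
  exists (star V S2); first by exists V.
  by exists x0 => //; exact: VW.
move=> z [A [GA [b [Ab Bb]]] Az] /=.
apply: (@chained_trans _ _ _ _ b).
  by apply: chained_sub (Bx0 b Bb) => // x; exact: VW.
have fVb : V (f b) by have [] := chained_in (Bx0 b Bb).
have [<-|bz] := pselect (b = z); first by apply: chained_refl; exact: VW.
have [|C [V' V2V' [c _ <-]] AC] := GUV A GA; first by exists b, z.
have /= cb := AC b Ab; have /= cz := AC z Az.
apply: (@chained_sub _ U2 _ (f @^-1` V')) => //.
  move=> x V'x; exists V' => //; split; first by left.
  by exists (f b); split => //; have [] := chained_in cb.
by apply: chained_trans cz; exact: chained_sym.
Qed.

(* The carrier of the space X_f is [X] itself. *)
Definition light_structure : ls_structure X :=
  LsStructure (light_nonempty LX LY f) (@light_refines _ _ LX LY f) light_star.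

End light_star.

Section metric.
Variables (R : realType) (X : metricType R).

(* [diam set0 = -oo], so the empty set is bounded. *)
Definition diam (A : set X) : \bar R :=
  ereal_sup [set (mdist x y)%:E | x in A & y in A].

Definition metric_bounded (A : set X) := exists M : R, (diam A <= M%:E)%E.

Definition proper_metric :=
  forall A : set X, closed A -> metric_bounded A -> compact A.

Definition uniformly_bounded (F : family X) :=
  exists2 M : R, 0 < M & forall U, F U -> (diam U <= M%:E)%E.

Lemma diam_leP (A : set X) (M : R) :
  (diam A <= M%:E)%E <-> forall x y, A x -> A y -> mdist x y <= M.
Proof.
split=> [AM x y Ax Ay|AM].
  rewrite -lee_fin; apply: le_trans AM; apply: ereal_sup_ubound.
  by exists x => //; exists y.
by apply: ge_ereal_sup => _ [x Ax [y Ay <-]]; rewrite lee_fin AM.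
Qed.

Lemma uniformly_bounded_nonempty : exists F, uniformly_bounded F.
Proof. by exists set0, 1. Qed.

Lemma uniformly_bounded_refines F G :
  uniformly_bounded G -> refines F G -> uniformly_bounded F.
Proof.
move=> [M M0 GM] FG; exists M => // U FU; apply/diam_leP => x y Ux Uy.
have [->|xy] := eqVneq x y; first by rewrite mdistxx ltW.
have [|C GC UC] := FG U FU; first by exists x, y; split => //; exact/eqP.
by have /diam_leP := GM C GC; apply; exact: UC.
Qed.

Lemma uniformly_bounded_star F G : uniformly_bounded F ->
  uniformly_bounded G -> uniformly_bounded [set star B G | B in F].
Proof.
move=> [M M0 FM] [N N0 GN]; exists (N + (M + N)); first by rewrite !addr_gt0.
move=> _ [B FB <-]; apply/diam_leP => x y.
move=> [A [GA [a [Aa Ba]]] Ax] [A' [GA' [a' [A'a' Ba']]] A'y].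
apply: le_trans (metric_triangle _ a _) _; apply: lerD.
  by have /diam_leP := GN A GA; apply.
apply: le_trans (metric_triangle _ a' _) _; apply: lerD.
  by have /diam_leP := FM B FB; apply.
by have /diam_leP := GN A' GA'; apply.
Qed.

Definition metric_ls : ls_structure X :=
  LsStructure uniformly_bounded_nonempty uniformly_bounded_refines
    uniformly_bounded_star.

Lemma metric_bounded0 : metric_bounded set0.
Proof. by exists 0; apply/diam_leP. Qed.

Lemma metric_boundedU (A B : set X) :
  metric_bounded A -> metric_bounded B -> metric_bounded (A `|` B).
Proof.
have [->|/set0P[a Aa]] := eqVneq A set0; first by rewrite set0U.
have [->|/set0P[b Bb]] := eqVneq B set0; first by rewrite setU0.
move=> [M /diam_leP AM] [N /diam_leP BN].
have M0 : 0 <= M by rewrite -(mdistxx a) AM.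
have N0 : 0 <= N by rewrite -(mdistxx b) BN.
exists (M + mdist a b + N); apply/diam_leP.
suff AB x y : A x -> B y -> mdist x y <= M + mdist a b + N.
  move=> x y [Ax|Bx] [Ay|By].
  - apply: le_trans (AM x y Ax Ay) _.
    by rewrite -addrA lerDl addr_ge0// mdist_ge0.
  - exact: AB.
  - by rewrite metric_sym AB.
  - apply: le_trans (BN x y Bx By) _.
    by rewrite lerDr addr_ge0// mdist_ge0.
move=> Ax By; apply: le_trans (metric_triangle _ b _) _; apply: lerD; last first.
  exact: BN.
by apply: le_trans (metric_triangle _ a _) _; rewrite lerD2r AM.
Qed.

End metric.

Definition coarse_map (R : realType) (X Y : metricType R) (f : X -> Y) :=
  ls_continuous (metric_ls X) (metric_ls Y) f /\
  forall B : set Y, metric_bounded B -> metric_bounded (f @^-1` B).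

Definition coarsely_monotone (R : realType) (X Y : metricType R) (f : X -> Y) :=
  coarse_equivalence (light_structure (metric_ls X) (metric_ls Y) f)
    (metric_ls Y) f.

Lemma ls_continuous_mdist (R : realType) (X Y : metricType R) (f : X -> Y) :
  ls_continuous (metric_ls X) (metric_ls Y) f ->
  forall r : R, 0 < r -> exists2 s : R, 0 < s &
    forall x x', mdist x x' <= r -> mdist (f x) (f x') <= s.
Proof.
move=> fls r r0.
have [|s s0 fs] := fls [set U | (diam U <= r%:E)%E]; first by exists r.
exists s => // x x' xx'.
have /diam_leP : (diam (f @` [set x; x']) <= s%:E)%E.
  apply: fs; exists [set x; x'] => //=; apply/diam_leP.
  by move=> _ _ [->|->] [->|->]; rewrite ?mdistxx ?(ltW r0) // metric_sym.
by apply; [exists x => //; left|exists x' => //; right].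
Qed.

Section higson_algebra.
Variables (R : realType) (X : metricType R).
Local Notation C := R[i].

Definition bounded_function (g : X -> C) :=
  exists M : R, forall x, `|g x| <= M%:C.

Definition slowly_oscillating (g : X -> C) :=
  forall r e : R, 0 < r -> 0 < e -> exists2 B : set X, metric_bounded B &
    forall x x', ~ B x -> ~ B x' -> mdist x x' <= r -> `|g x - g x'| <= e%:C.

Definition tends_to0 (g : X -> C) :=
  forall e : R, 0 < e -> exists2 B : set X, metric_bounded B &
    forall x, ~ B x -> `|g x| <= e%:C.

Definition Bh_pred : {pred X -> C} :=
  fun g => `[< bounded_function g /\ slowly_oscillating g >].

Lemma Bh_predP g :
  reflect (bounded_function g /\ slowly_oscillating g) (g \in Bh_pred).
Proof. exact: asboolP. Qed.

Lemma bounded_function_gt0 g : bounded_function g ->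
  exists2 M : R, 0 < M & forall x, `|g x| <= M%:C.
Proof.
move=> [M gM]; exists (`|M| + 1); first by rewrite ltr_wpDl.
move=> x; apply: le_trans (gM x) _; rewrite lecR.
by rewrite (le_trans (ler_norm _))// lerDl.
Qed.

Lemma Bh_subring_closed : subring_closed Bh_pred.
Proof.
split.
- apply/Bh_predP; split; first by exists 1 => x; rewrite normr1.
  move=> r e _ e0; exists set0; first exact: metric_bounded0.
  by move=> x x' _ _ _; rewrite subrr normr0 ler0c ltW.
- move=> g h /Bh_predP[[M gM] gso] /Bh_predP[[N hN] hso]; apply/Bh_predP; split.
    exists (M + N) => x; rewrite rmorphD/=.
    by apply: le_trans (ler_normB _ _) _; exact: lerD.
  move=> r e r0 e0; have e20 : 0 < e / 2 by rewrite divr_gt0.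
  have [B bB gB] := gso r _ r0 e20; have [D bD hD] := hso r _ r0 e20.
  exists (B `|` D); first exact: metric_boundedU.
  move=> x x' /not_orP[Bx Dx] /not_orP[Bx' Dx'] xx'.
  rewrite (_ : (g - h) x - (g - h) x' = (g x - g x') - (h x - h x')); last first.
    rewrite (_ : (g - h) x = g x - h x)// (_ : (g - h) x' = g x' - h x')//.
    by rewrite !opprB addrACA [RHS]addrACA [- h x - _]addrC.
  rewrite [e]splitr rmorphD/=.
  apply: le_trans (ler_normB _ _) _; apply: lerD; [exact: gB|exact: hD].
- move=> g h /Bh_predP[gb gso] /Bh_predP[hb hso]; apply/Bh_predP.
  have [M M0 gM] := bounded_function_gt0 gb.
  have [N N0 hN] := bounded_function_gt0 hb; split.
    exists (M * N) => x; rewrite rmorphM/= normrM.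
    by apply: ler_pM.
  move=> r e r0 e0.
  have e1 : 0 < e / 2 / N by rewrite !divr_gt0.
  have e2 : 0 < e / 2 / M by rewrite !divr_gt0.
  have [B bB gB] := gso r _ r0 e1; have [D bD hD] := hso r _ r0 e2.
  exists (B `|` D); first exact: metric_boundedU.
  move=> x x' /not_orP[Bx Dx] /not_orP[Bx' Dx'] xx'.
  rewrite (_ : _ - _ = (g x - g x') * h x + g x' * (h x - h x')); last first.
    by rewrite mulrBl mulrBr addrA subrK.
  rewrite (_ : e = e / 2 / N * N + M * (e / 2 / M)); last first.
    by rewrite [M * _]mulrC !divfK ?gt_eqF// -splitr.
  rewrite rmorphD [X in _ <= X + _]rmorphM [X in _ <= _ + X]rmorphM/=.
  apply: le_trans (ler_normD _ _) _; rewrite !normrM; apply: lerD.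
    by apply: ler_pM => //; exact: gB.
  by apply: ler_pM => //; exact: hD.
Qed.

HB.instance Definition _ :=
  GRing.isSubringClosed.Build (X -> C) Bh_pred Bh_subring_closed.

Lemma cst_Bh (c : C) : (cst c : X -> C) \in Bh_pred.
Proof.
apply/Bh_predP; split.
  by exists (Num.sqrt (complex.Re c ^+ 2 + complex.Im c ^+ 2)) => x; rewrite normc_def.
move=> r e _ e0; exists set0; first exact: metric_bounded0.
by move=> x x' _ _ _; rewrite subrr normr0 ler0c ltW.
Qed.

Lemma Bh_scaler_closed : GRing.scaler_closed Bh_pred.
Proof.
move=> c g gB; rewrite (_ : c *: g = cst c * g)//; first exact: rpredM (cst_Bh c) gB.
Qed.

HB.instance Definition _ :=
  GRing.isScaleClosed.Build C (X -> C) Bh_pred Bh_scaler_closed.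

Record Bh := MkBh { Bh_fun :> X -> C; Bh_funP : Bh_fun \in Bh_pred }.

HB.instance Definition _ := [isSub for Bh_fun].
HB.instance Definition _ := [Choice of Bh by <:].
HB.instance Definition _ := 
  GRing.SubChoice_isSubComPzRing.Build (X -> C) Bh_pred Bh (subringClosedP _).
HB.instance Definition _ := [SubZmodule_isSubLmodule of Bh by <:].

Definition B0_pred : {pred Bh} := fun g => `[< tends_to0 g >].

Lemma B0_predP (g : Bh) : reflect (tends_to0 g) (g \in B0_pred).
Proof. exact: asboolP. Qed.

Lemma B0_zmod_closed : zmod_closed B0_pred.
Proof.
split=> [|g h /B0_predP g0 /B0_predP h0]; apply/B0_predP.
  move=> e e0; exists set0; first exact: metric_bounded0.
  by move=> x _; rewrite normr0 ler0c ltW.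
move=> e e0; have e20 : 0 < e / 2 by rewrite divr_gt0.
have [B bB gB] := g0 _ e20; have [D bD hD] := h0 _ e20.
exists (B `|` D); first exact: metric_boundedU.
move=> x /not_orP[Bx Dx]; rewrite [e]splitr rmorphD/=.
by apply: le_trans (ler_normB _ _) _; apply: lerD; [exact: gB|exact: hD].
Qed.

HB.instance Definition _ := GRing.isZmodClosed.Build Bh B0_pred B0_zmod_closed.

Lemma B0_ideal (g h : Bh) : h \in B0_pred -> g * h \in B0_pred.
Proof.
move=> /B0_predP h0; apply/B0_predP => e e0.
have [/bounded_function_gt0[M M0 gM] _] := Bh_predP _ (Bh_funP g).
have [|B bB hB] := h0 (e / M); first by rewrite divr_gt0.
exists B => // x Bx; rewrite (_ : e = M * (e / M)); last first.
  by rewrite mulrC divfK// gt_eqF.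
rewrite [X in _ <= X]rmorphM normrM/=; apply: ler_pM => //; exact: hB.
Qed.

Lemma B0_scale (c : C) (h : Bh) : h \in B0_pred -> c *: h \in B0_pred.
Proof.
move=> h0; rewrite (_ : c *: h = MkBh (cst_Bh c) * h); first exact: B0_ideal.
exact: val_inj.
Qed.

(* The quotient ring of [ring_quotient] requires a proper ideal, whereas
   [B0_pred] is everything when [X] is bounded. *)
Definition higson_algebra : Type := Quotient.quot B0_pred.
Local Notation Q := higson_algebra.

HB.instance Definition _ := Choice.on Q.
HB.instance Definition _ := GRing.Zmodule.on Q.
HB.instance Definition _ :=
  EqQuotient.copy Q (Quotient.quot B0_pred).
HB.instance Definition _ := ZmodQuotient.copy Q (Quotient.quot B0_pred).

Lemma higson_eqP (g h : Bh) :
  reflect (\pi_Q g = \pi_Q h) (g - h \in B0_pred).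
Proof. by rewrite Quotient.idealrBE; exact: eqP. Qed.

Definition higson_one : Q := \pi_Q 1.
Definition higson_mul (a b : Q) : Q := \pi_Q (repr a * repr b).
Definition higson_scale (c : C) (a : Q) : Q := \pi_Q (c *: repr a).

Lemma higson_piP (a : Q) : exists g, a = \pi_Q g.
Proof. by exists (repr a); rewrite reprK. Qed.

Lemma pi_higsonD (g h : Bh) : \pi_Q (g + h) = \pi_Q g + \pi_Q h.
Proof. exact: (@raddfD _ _ (\pi_Q : {additive Bh -> Q})). Qed.

Lemma higson_piM (g h : Bh) :
  higson_mul (\pi_Q g) (\pi_Q h) = \pi_Q (g * h).
Proof.
apply/higson_eqP; set g' := repr _; set h' := repr _.
have gg' : g' - g \in B0_pred by apply/higson_eqP; rewrite reprK.
have hh' : h' - h \in B0_pred by apply/higson_eqP; rewrite reprK.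
rewrite (_ : _ - _ = h' * (g' - g) + g * (h' - h)).
  by rewrite rpredD ?B0_ideal.
by rewrite !mulrBr [h' * g']mulrC [h' * g]mulrC addrA subrK.
Qed.

Lemma higson_piZ (c : C) (g : Bh) :
  higson_scale c (\pi_Q g) = \pi_Q (c *: g).
Proof.
apply/higson_eqP; rewrite -scalerBr B0_scale//.
by apply/higson_eqP; rewrite reprK.
Qed.

Lemma higson_mulA : associative higson_mul.
Proof.
move=> a b c; have [g ->] := higson_piP a; have [h ->] := higson_piP b.
have [k ->] := higson_piP c.
by rewrite (higson_piM h k) (higson_piM g h) !(higson_piM _ _) mulrA.
Qed.

Lemma higson_mulC : commutative higson_mul.
Proof. by move=> a b; rewrite /higson_mul mulrC. Qed.

Lemma higson_mul1 : left_id higson_one higson_mul.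
Proof. by move=> a; rewrite -[a]reprK higson_piM mul1r. Qed.

Lemma higson_mulDl : left_distributive higson_mul +%R.
Proof.
move=> a b c; have [g ->] := higson_piP a; have [h ->] := higson_piP b.
have [k ->] := higson_piP c.
rewrite -(pi_higsonD g h) (higson_piM (g + h) k) mulrDl pi_higsonD.
by rewrite (higson_piM g k) (higson_piM h k).
Qed.

HB.instance Definition _ := GRing.Zmodule_isComPzRing.Build Q
  higson_mulA higson_mulC higson_mul1 higson_mulDl.

Lemma higson_scaleA (c d : C) (a : Q) :
  higson_scale c (higson_scale d a) = higson_scale (c * d) a.
Proof.
have [g ->] := higson_piP a.
by rewrite (higson_piZ d g) (higson_piZ c) (higson_piZ (c * d) g) scalerA.
Qed.

Lemma higson_scale1 : left_id 1 higson_scale.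
Proof.
by move=> a; have [g ->] := higson_piP a; rewrite (higson_piZ 1 g) scale1r.
Qed.

Lemma higson_scaleDr : right_distributive higson_scale +%R.
Proof.
move=> c a b; have [g ->] := higson_piP a; have [h ->] := higson_piP b.
rewrite -(pi_higsonD g h) (higson_piZ c (g + h)) scalerDr pi_higsonD.
by rewrite (higson_piZ c g) (higson_piZ c h).
Qed.

Lemma higson_scaleDl (a : Q) : {morph higson_scale^~ a : c d / c + d}.
Proof.
move=> c d /=; have [g ->] := higson_piP a.
rewrite (higson_piZ (c + d) g) scalerDl pi_higsonD.
by rewrite (higson_piZ c g) (higson_piZ d g).
Qed.

HB.instance Definition _ := GRing.Zmodule_isLmodule.Build C Q
  higson_scaleA higson_scale1 higson_scaleDr higson_scaleDl.

Lemma pi_higson1 : \pi_Q 1 = 1. Proof. by []. Qed.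

Lemma pi_higsonM (g h : Bh) : \pi_Q (g * h) = \pi_Q g * \pi_Q h.
Proof. by rewrite -higson_piM. Qed.

Lemma pi_higsonZ (c : C) (g : Bh) : \pi_Q (c *: g) = c *: \pi_Q g.
Proof. by rewrite -higson_piZ. Qed.

(* Gelfand spectrum: the unital algebra homomorphisms to the complex numbers,
   as a subspace of the product of copies of the complex plane. The algebra is
   zero when [X] is bounded, and then there is no such homomorphism. *)
Definition higson_characters : set {ptws Q -> C^o} :=
  [set chi : Q -> C^o | linear chi /\ monoid_morphism chi].

Definition higson_corona : topologicalType := set_type higson_characters.

End higson_algebra.

Arguments Bh_pred {R} X _.
Arguments B0_pred {R} X _.
Arguments higson_characters {R} X _.

Section higson_map.
Variables (R : realType) (X Y : metricType R) (f : X -> Y).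
Hypothesis cf : coarse_map f.
Local Notation C := R[i].

Lemma Bh_comp (g : Bh Y) : (g \o f : X -> C) \in Bh_pred X.
Proof.
have [fls fb] := cf; have /Bh_predP[[M gM] gso] := Bh_funP g.
apply/Bh_predP; split; first by exists M => x; exact: gM.
move=> r e r0 e0; have [s s0 fs] := ls_continuous_mdist fls r0.
have [B bB gB] := gso s e s0 e0; exists (f @^-1` B); first exact: fb.
by move=> x x' Bx Bx' xx'; apply: gB => //; exact: fs.
Qed.

Definition Bh_pullback (g : Bh Y) : Bh X := MkBh (Bh_comp g).

Lemma B0_pullback (g : Bh Y) :
  g \in B0_pred Y -> Bh_pullback g \in B0_pred X.
Proof.
have [_ fb] := cf => /B0_predP g0; apply/B0_predP => e e0.
have [B bB gB] := g0 e e0; exists (f @^-1` B); first exact: fb.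
by move=> x Bx; exact: gB.
Qed.

Definition higson_pullback (a : higson_algebra Y) : higson_algebra X :=
  \pi_(higson_algebra X) (Bh_pullback (repr a)).

Lemma higson_pullback_pi (g : Bh Y) :
  higson_pullback (\pi_(higson_algebra Y) g) =
  \pi_(higson_algebra X) (Bh_pullback g).
Proof.
apply/higson_eqP; set g' := repr _.
have gg' : g' - g \in B0_pred Y by apply/higson_eqP; rewrite reprK.
rewrite (_ : _ - _ = Bh_pullback (g' - g)); first exact: B0_pullback.
exact: val_inj.
Qed.

Lemma higson_pullback_linear : linear higson_pullback.
Proof.
move=> c a b; have [g ->] := higson_piP a; have [h ->] := higson_piP b.
rewrite -pi_higsonZ -pi_higsonD (higson_pullback_pi (c *: g + h)).
rewrite (higson_pullback_pi g) (higson_pullback_pi h).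
rewrite -pi_higsonZ -pi_higsonD.
by congr (\pi); exact: val_inj.
Qed.

Lemma higson_pullback_monoid : monoid_morphism higson_pullback.
Proof.
split.
  rewrite -!pi_higson1 (higson_pullback_pi 1).
  by congr (\pi); exact: val_inj.
move=> a b; have [g ->] := higson_piP a; have [h ->] := higson_piP b.
rewrite -pi_higsonM (higson_pullback_pi (g * h)).
rewrite (higson_pullback_pi g) (higson_pullback_pi h) -pi_higsonM.
by congr (\pi); exact: val_inj.
Qed.

Lemma higson_map_subproof (chi : higson_corona X) :
  higson_characters Y (set_val chi \o higson_pullback).
Proof.
have [chiL [chi1 chiM]] : higson_characters X (set_val chi) by exact: set_valP.
have [f1 fM] := higson_pullback_monoid; split.
  by move=> c a b /=; rewrite higson_pullback_linear chiL.
by split=> [|a b] /=; rewrite ?f1 ?fM.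
Qed.

Definition higson_map (chi : higson_corona X) : higson_corona Y :=
  SigSub (mem_set (higson_map_subproof chi)).

End higson_map.

Definition monotone_map (S T : topologicalType) (h : S -> T) :=
  [/\ continuous h, set_surj [set: S] [set: T] h &
      forall t : T, connected (h @^-1` [set t])].
Lemma higson_eval_continuous (R : realType) (X : metricType R)
    (a : higson_algebra X) :
  continuous (fun chi : higson_corona X => set_val chi a : R[i]^o).
Proof.
move=> chi; apply: (@cvg_comp _ _ _ set_val
  (fun k : {ptws higson_algebra X -> R[i]^o} => k a)
  _ (nbhs (set_val chi : {ptws higson_algebra X -> R[i]^o}))).
  exact: initial_continuous.
exact: (@proj_continuous _ (fun=> R[i]^o) a).
Qed.

Lemma higson_map_continuous (R : realType) (X Y : metricType R) (f : X -> Y)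
  (cf : coarse_map f) : continuous (higson_map cf).
Proof.
apply: continuous_comp_initial => chi.
have FF : Filter ((set_val \o higson_map cf) @ chi).
  by apply: fmap_filter; exact: nbhs_filter.
apply/cvg_sup => a.
apply: (@continuous_comp_initial _ _ _
  (fun k : higson_algebra Y -> R[i]^o => k a)
  (fun chi => set_val (higson_map cf chi))).
exact: (@higson_eval_continuous R X (higson_pullback cf a)).
Qed.

(* Main.v *)
(* Coarse monotonicity says that f is coarsely surjective and that for every r
   there is s such that points with r-close images are joined by an s-chain
   inside the preimage of an s-ball. Characters of the Higson algebra are limits
   along filters on X at infinity, so points of the corona can be pushed around
   with ultrafilters.

   If f is coarsely monotone, a clopen splitting of a fibre over eta is detected
   by a slowly oscillating h taking values away from an interval on the preimage
   of a neighbourhood of eta. Since h varies slowly, it cannot jump along an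
   s-chain, so the images of its two level sets are asymptotically disjoint in Y;
   a slowly oscillating Urysohn function on Y separates them, although both have
   eta in their closure.

   Conversely, if the chain condition fails there are pairs x_n, x'_n with close
   images, not t_n-chained over the ball of radius t_n about f x_n, where these
   balls are far apart. The union A of the chain components of the x_n is
   asymptotically disjoint from its complement in the preimage of the balls, and
   the Urysohn function of this pair disconnects the fibre containing the limits
   of x_n and x'_n. *)

Require Import Defs.
From mathcomp Require Import all_boot all_order all_algebra.
From mathcomp Require Import all_classical all_reals all_analysis.
From mathcomp Require Import complex generic_quotient ring_quotient.
From mathcomp Require Import ring lra.

Set Implicit Arguments.
Unset Strict Implicit.
Unset Printing Implicit Defensive.

Import Order.TTheory GRing.Theory Num.Theory.
Import numFieldNormedType.Exports.

Local Open Scope classical_set_scope.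
Local Open Scope ring_scope.
Local Open Scope complex_scope.
Local Open Scope quotient_scope.

(** * Complex-valued limits along filters and ultrafilters *)

Lemma normc_real (R : realType) (t : R) : `|t%:C| = `|t|%:C.
Proof. by rewrite normc_def /= expr0n addr0 sqrtr_sqr. Qed.

Lemma cvg_complexP (R : realType) (T : Type) (F : set_system T) {FF : Filter F}
    (g : T -> R[i]^o) (c : R[i]^o) :
  g @ F --> c <->
  forall e : R, 0 < e -> \forall x \near F, `|c - g x| <= e%:C.
Proof.
split=> [/cvgrPdist_le gc e e0|gc].
  by apply: gc; rewrite ltcR.
(* In the order on [R[i]] a positive [e] has imaginary part zero, so real tolerances suffice. *)
apply/cvgrPdist_le => e; rewrite ltcE /= => /andP[/eqP ie re].
have -> : e = (complex.Re e)%:C by rewrite [LHS]complexE ie rmorph0 mulr0 addr0.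
exact: gc.
Qed.

Lemma cvg_realP (R : realType) (T : Type) (F : set_system T) {FF : Filter F}
    (h : T -> R) (t : R) :
  (fun x => (h x)%:C : R[i]^o) @ F --> (t%:C : R[i]^o) <->
  forall e : R, 0 < e -> \forall x \near F, `|t - h x| <= e.
Proof.
rewrite cvg_complexP; split=> ht e /ht; apply: filterS => x;
  by rewrite -rmorphB normc_real lecR.
Qed.

Lemma complex_cvg_unique (R : realType) (T : Type) (F : set_system T)
    {FF : ProperFilter F} (g : T -> R[i]^o) (c d : R[i]^o) :
  g @ F --> c -> g @ F --> d -> c = d.
Proof. by apply: cvg_unique; exact: norm_hausdorff. Qed.

(** The segment is compact, so the image ultrafilter has a cluster point, and an ultrafilter
    converges to its cluster points. *)
Lemma ultra_bounded_real_cvg (R : realType) (T : Type) (F : set_system T)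
    (h : T -> R) (M : R) : UltraFilter F -> (forall x, `|h x| <= M) ->
  exists t : R, h @ F --> t.
Proof.
move=> FU hM; have FP : ProperFilter F by exact: ultra_proper.
have hin : F (h @^-1` `[- M, M]).
  by apply: filterE => x /=; rewrite in_itv /= -ler_norml.
have [t [_ clt]] := @segment_compact R (- M) M (h @ F) _ hin.
exists t => V Vt; have [//|nV] := in_ultra_setVsetC (h @^-1` V) FU.
have [s []] := clt (~` V) V (filterS (fun=> id) nV) Vt.
by [].
Qed.

Lemma ultra_bounded_cvg (R : realType) (T : Type) (F : set_system T)
    (g : T -> R[i]^o) (M : R) : UltraFilter F -> (forall x, `|g x| <= M%:C) ->
  exists c : R[i]^o, g @ F --> c.
Proof.
move=> FU gM; have FP : ProperFilter F by exact: ultra_proper.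
have ReM x : `|complex.Re (g x)| <= M.
  by rewrite -lecR; exact: le_trans (normc_ge_Re _) (gM x).
have ImM x : `|complex.Im (g x)| <= M.
  have -> : complex.Im (g x) = - complex.Re (g x * 'i%C).
    by rewrite ReiNIm opprK.
  rewrite normrN -lecR; apply: le_trans (normc_ge_Re _) _.
  by rewrite normrM [ `|'i%C| ]normc_def /= expr0n expr1n add0r sqrtr1 mulr1.
have [a /cvgrPdist_le ha] := ultra_bounded_real_cvg FU ReM.
have [b /cvgrPdist_le hb] := ultra_bounded_real_cvg FU ImM.
exists (a%:C + 'i%C * b%:C); apply/cvg_complexP => e e0.
have e2 : 0 < e / 2 by rewrite divr_gt0.
near=> x; rewrite [g x]complexE opprD addrACA -mulrBr -!rmorphB.
apply: le_trans (ler_normD _ _) _.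
rewrite normrM [ `|'i%C| ]normc_def /= expr0n expr1n add0r sqrtr1 mul1r.
rewrite !normc_real -rmorphD lecR [e]splitr; apply: lerD.
  by near: x; exact: ha.
by near: x; exact: hb.
Unshelve. all: by end_near. Qed.

(** * Bounded sets and slowly oscillating Urysohn functions *)

Section bounded_sets.
Variables (R : realType) (X : metricType R).

Lemma metric_bounded_sub (A B : set X) :
  A `<=` B -> metric_bounded B -> metric_bounded A.
Proof.
by move=> AB [M /diam_leP BM]; exists M; apply/diam_leP => x y /AB ? /AB ?; exact: BM.
Qed.

Lemma metric_boundedP (o : X) (A : set X) :
  metric_bounded A <-> exists M : R, forall x, A x -> mdist o x <= M.
Proof.
split=> [[M /diam_leP AM]|[M AM]]; last first.
  exists (M + M); apply/diam_leP => x y Ax Ay.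
  apply: le_trans (metric_triangle _ o _) _.
  by rewrite lerD ?AM // metric_sym AM.
have [->|/set0P[a Aa]] := eqVneq A set0; first by exists 0.
exists (mdist o a + M) => x Ax; apply: le_trans (metric_triangle _ a _) _.
by rewrite lerD2l AM.
Qed.

Definition thicken (A : set X) (r : R) : set X :=
  [set x | exists2 a, A a & mdist a x <= r].

Lemma thicken_bounded (A : set X) (r : R) :
  metric_bounded A -> metric_bounded (thicken A r).
Proof.
have [->|/set0P[p _]] := eqVneq A set0.
  move=> _; by apply: metric_bounded_sub (@metric_bounded0 R X) => x [].
move=> /(metric_boundedP p)[M AM]; apply/(metric_boundedP p); exists (M + r).
move=> x [a /AM oa ax]; apply: le_trans (metric_triangle _ a _) _.
exact: lerD.
Qed.

Lemma image_bounded (Y : metricType R) (f : X -> Y) (A : set X) :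
  ls_continuous (metric_ls X) (metric_ls Y) f ->
  metric_bounded A -> metric_bounded (f @` A).
Proof.
move=> /ls_continuous_mdist fls [M /diam_leP AM].
have [|s s0 fs] := fls (`|M| + 1); first by rewrite ltr_wpDl.
exists s; apply/diam_leP => _ _ [x Ax <-] [y Ay <-]; apply: fs.
by rewrite (le_trans (AM _ _ Ax Ay)) // (le_trans (ler_norm _)) // lerDl.
Qed.

Definition asymptotically_disjoint (A B : set X) :=
  forall r : R, metric_bounded (thicken A r `&` thicken B r).

Lemma real_BhP (h : X -> R) (M : R) : (forall x, `|h x| <= M) ->
  (forall r e : R, 0 < r -> 0 < e -> exists2 B : set X, metric_bounded B &
    forall x x', ~ B x -> ~ B x' -> mdist x x' <= r -> `|h x - h x'| <= e) ->
  (fun x => (h x)%:C) \in Bh_pred X.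
Proof.
move=> hM hso; apply/Bh_predP; split.
  by exists M => x; rewrite normc_real lecR.
move=> r e r0 e0; have [B bB hB] := hso r e r0 e0; exists B => // x x' Bx Bx' xx'.
by rewrite -rmorphB normc_real lecR hB.
Qed.

(** [inf] of the empty set is [0], so this is a distance only for nonempty [A]; hence the witness
    [a0] below. *)
Definition dist_to (A : set X) (x : X) : R := inf [set mdist x a | a in A].

Section dist_to.
Variables (A : set X) (a0 : X).
Hypothesis Aa0 : A a0.

Let has_infA x : has_inf [set mdist x a | a in A].
Proof.
split; first by exists (mdist x a0), a0.
by exists 0 => _ [a _ <-]; exact: mdist_ge0.
Qed.

Lemma dist_to_ge0 x : 0 <= dist_to A x.
Proof.
apply: lb_le_inf; first by case: (has_infA x).
by move=> _ [a _ <-]; exact: mdist_ge0.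
Qed.

Lemma dist_to_le x a : A a -> dist_to A x <= mdist x a.
Proof. by move=> Aa; apply: ge_inf; [case: (has_infA x)|exists a]. Qed.

Lemma dist_to0 x : A x -> dist_to A x = 0.
Proof.
move=> Ax; apply/eqP; rewrite eq_le dist_to_ge0 andbT.
by rewrite -(mdistxx x); exact: dist_to_le.
Qed.

Lemma dist_to_lt x r : dist_to A x < r -> thicken A r x.
Proof.
rewrite -subr_gt0 => xr; have [_ [a Aa <-]] := inf_adherent xr (has_infA x).
rewrite addrC subrK => /ltW xa; exists a => //; by rewrite metric_sym.
Qed.

Lemma dist_to_lip x y : dist_to A x <= dist_to A y + mdist x y.
Proof.
rewrite -lerBlDr; apply: lb_le_inf; first by case: (has_infA y).
move=> _ [a Aa <-]; rewrite lerBlDr addrC.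
by apply: le_trans (metric_triangle _ y _); exact: dist_to_le.
Qed.

End dist_to.

(** The numerator of the difference is at most [r * (a' + b')] in absolute value, which cancels the
    second denominator. *)
Lemma ratio_lip (a b a' b' r : R) : 0 <= a -> 0 <= b -> 0 <= a' -> 0 <= b' ->
  0 < a + b -> 0 < a' + b' -> `|a - a'| <= r -> `|b - b'| <= r ->
  `|a / (a + b) - a' / (a' + b')| <= r / (a + b).
Proof.
move=> a0 b0 a'0 b'0 ab ab' aa bb.
have -> : a / (a + b) - a' / (a' + b') =
    ((a - a') * b' + a' * (b' - b)) / ((a' + b') * (a + b)).
  by field; rewrite !gt_eqF.
rewrite normrM normfV (ger0_norm (mulr_ge0 (ltW ab') (ltW ab))).
rewrite ler_pdivrMr ?mulr_gt0 // mulrCA [r / _ * _]divfK ?gt_eqF //.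
apply: le_trans (ler_normD _ _) _; rewrite !normrM.
rewrite (ger0_norm b'0) (ger0_norm a'0) [X in _ <= X]mulrDl [X in X <= _]addrC.
by rewrite [b' * r]mulrC lerD ?ler_wpM2l ?ler_wpM2r // distrC.
Qed.

(** The function is [u / (u + v)] with [u], [v] the distances to [A] and [A']. Points with
    [u + v < s] lie in both thickenings by [s], so off a bounded set the denominator is large and
    the quotient varies slowly. The value on [A'] has an exceptional set because a point of both
    sets gets the value [0]. *)
Lemma Urysohn_Bh (A A' : set X) : asymptotically_disjoint A A' ->
  exists2 h : X -> R, (fun x => (h x)%:C) \in Bh_pred X &
    [/\ forall x, 0 <= h x <= 1, forall x, A x -> h x = 0 &
        exists2 B, metric_bounded B & forall x, A' x -> ~ B x -> h x = 1].
Proof.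
move=> AA'; have [->|/set0P[a Aa]] := eqVneq A set0.
  exists (fun=> 1); first exact: (cst_Bh X 1).
  split=> // [x|]; first by rewrite lexx ler01.
  by exists set0 => //; exact: metric_bounded0.
have [->|/set0P[a' Aa']] := eqVneq A' set0.
  exists (fun=> 0); first exact: (cst_Bh X 0).
  split=> // [x|]; first by rewrite lexx ler01.
  by exists set0 => //; exact: metric_bounded0.
pose u x := dist_to A x; pose v x := dist_to A' x.
have u0 x : 0 <= u x by exact: dist_to_ge0 Aa x.
have v0 x : 0 <= v x by exact: dist_to_ge0 Aa' x.
have small s x : u x + v x < s -> (thicken A s `&` thicken A' s) x.
  by move=> us; split; [apply: dist_to_lt Aa _ _ _|apply: dist_to_lt Aa' _ _ _];
    apply: le_lt_trans us; rewrite ?lerDl ?lerDr.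
have lip A1 a1 x x' r : A1 a1 -> mdist x x' <= r ->
    `|dist_to A1 x - dist_to A1 x'| <= r.
  move=> A1a xr; rewrite ler_distlC; have xr' : mdist x' x <= r.
    by rewrite metric_sym.
  by rewrite lerBlDr (le_trans (dist_to_lip A1a x' x)) ?lerD2l //
    (le_trans (dist_to_lip A1a x x')) ?lerD2l.
have h01 x : 0 <= u x / (u x + v x) <= 1.
  rewrite divr_ge0 ?addr_ge0 //=.
  have [->|uv] := eqVneq (u x + v x) 0; first by rewrite invr0 mulr0.
  have uv0 : 0 < u x + v x by rewrite lt_def uv addr_ge0.
  by rewrite ler_pdivrMr // mul1r lerDl.
exists (fun x => u x / (u x + v x)).
  apply: (@real_BhP _ 1) => [x|r e r0 e0].
    by have /andP[? ?] := h01 x; rewrite ger0_norm.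
  (* Outside this set [u + v >= r / e], which turns the bound [r / (u + v)] of [ratio_lip] into
     [e]. *)
  exists (thicken A (r / e) `&` thicken A' (r / e)) => // x x' nx nx' xx'.
  have big z : ~ (thicken A (r / e) `&` thicken A' (r / e)) z ->
      r / e <= u z + v z.
    by move=> nz; rewrite leNgt; apply/negP => /small.
  have re : 0 < r / e by rewrite divr_gt0.
  have ux := lt_le_trans re (big _ nx); have ux' := lt_le_trans re (big _ nx').
  apply: le_trans (ratio_lip (u0 x) (v0 x) (u0 x') (v0 x') ux ux' _ _) _;
    [exact: lip Aa xx'|exact: lip Aa' xx'|].
  by rewrite ler_pdivrMr // mulrC -ler_pdivrMr // big.
split=> // [x Ax|]; first by rewrite /u (dist_to0 Ax Ax) mul0r.
exists (thicken A 1 `&` thicken A' 1) => // x A'x nx.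
have v0x : v x = 0 by rewrite /v (dist_to0 A'x A'x).
rewrite v0x addr0 divff //; apply/eqP => ux0; apply: nx; apply: small.
by rewrite ux0 v0x addr0.
Qed.

End bounded_sets.

(** * Characters as limits along filters *)

Section characters.
Variables (R : realType) (X : metricType R).
Local Notation Q := (higson_algebra X).

Definition at_infinity (T : Type) (F : set_system T) (u : T -> X) :=
  forall B, metric_bounded B -> F (u @^-1` (~` B)).

Definition ev (chi : higson_corona X) (g : Bh X) : R[i]^o :=
  set_val chi (\pi_Q g).

Let chiL (chi : higson_corona X) : linear (set_val chi : Q -> R[i]^o).
Proof. by case: (set_valP chi). Qed.

Lemma evD chi g h : ev chi (g + h) = ev chi g + ev chi h.
Proof.
rewrite /ev (pi_higsonD g h).
by have := chiL chi 1 (\pi_Q g) (\pi_Q h); rewrite !scale1r.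
Qed.

Lemma evM chi g h : ev chi (g * h) = ev chi g * ev chi h.
Proof.
have [_ [_ chiM]] : higson_characters X (set_val chi) by exact: set_valP.
by rewrite /ev (pi_higsonM g h); exact: chiM.
Qed.

Lemma ev1 chi : ev chi 1 = 1.
Proof. by have [_ []] : higson_characters X (set_val chi) by exact: set_valP. Qed.

Lemma ev0 chi : ev chi 0 = 0.
Proof. by apply: (addrI (ev chi 0)); rewrite -evD !addr0. Qed.

Lemma evZ chi c g : ev chi (c *: g) = c * ev chi g.
Proof.
rewrite -[c *: g]addr0 evD ev0 addr0 /ev (pi_higsonZ c g).
have := chiL chi c (\pi_Q g) (\pi_Q 0).
rewrite -(pi_higsonZ c g) -(pi_higsonD (c *: g) 0) addr0.
by rewrite -/(ev chi 0) ev0 addr0 pi_higsonZ.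
Qed.

Lemma evN chi g : ev chi (- g) = - ev chi g.
Proof. by rewrite -scaleN1r evZ mulN1r. Qed.

Lemma evB chi g h : ev chi (g - h) = ev chi g - ev chi h.
Proof. by rewrite evD evN. Qed.

Lemma ev_B0 chi g : g \in B0_pred X -> ev chi g = 0.
Proof.
move=> g0; rewrite -(ev0 chi) /ev; congr (set_val chi _).
by apply/higson_eqP; rewrite subr0.
Qed.

Lemma corona_ext (chi chi' : higson_corona X) :
  (forall g, ev chi g = ev chi' g) -> chi = chi'.
Proof.
move=> cc; apply: val_inj; apply/funext => a.
by have [g ->] := higson_piP a; exact: cc.
Qed.

Lemma Bh_conj (g : Bh X) : (fun x => (g x)^*%C) \in Bh_pred X.
Proof.
have /Bh_predP[[M gM] gso] := Bh_funP g; apply/Bh_predP; split.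
  by exists M => x; rewrite normcJ.
move=> r e r0 e0; have [B bB gB] := gso r e r0 e0; exists B => // x x' Bx Bx' xx'.
by rewrite -rmorphB normcJ gB.
Qed.

Lemma Bh_inv (g : Bh X) : (forall x, 1 <= g x) -> (fun x => (g x)^-1) \in Bh_pred X.
Proof.
have /Bh_predP[_ gso] := Bh_funP g => g1; apply/Bh_predP.
have g0 x : 0 < g x by exact: lt_le_trans ltr01 (g1 x).
split.
  by exists 1 => x; rewrite normfV ger0_norm ?(ltW (g0 x)) // invf_le1.
move=> r e r0 e0; have [B bB gB] := gso r e r0 e0; exists B => // x x' Bx Bx' xx'.
have -> : (g x)^-1 - (g x')^-1 = (g x' - g x) / (g x * g x').
  by field; rewrite !gt_eqF.
have gg : 1 <= g x * g x' by rewrite mulr_ege1.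
rewrite normrM normfV [ `|g x * _| ]ger0_norm ?(le_trans ler01 gg) //.
rewrite ler_pdivrMr ?(lt_le_trans ltr01 gg) //.
have /le_trans : `|g x' - g x| <= e%:C by rewrite distrC gB.
by apply; rewrite ler_peMr // ler0c ltW.
Qed.

(** The jump at the boundary of [B] is invisible to slow oscillation, which allows a bounded set to
    be discarded. *)
Lemma indic_Bh (B : set X) : metric_bounded B ->
  (fun x => (\1_B x : R)%:C) \in Bh_pred X.
Proof.
move=> bB; apply: (@real_BhP _ _ _ 1) => [x|r e r0 e0].
  by rewrite indicE; case: (x \in B); rewrite /= ?normr1 ?normr0.
exists B => // x x' Bx Bx' _; rewrite !indicE !memNset // subrr normr0.
exact: ltW.
Qed.

(* The traces on X of the neighbourhoods of chi. *)
Definition corona_filter (chi : higson_corona X) : set_system X :=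
  filter_from [set k : Bh X | (forall x, 0 <= k x) /\ ev chi k = 0]
    (fun k => [set x | k x < 1]).

Variable chi : higson_corona X.

Global Instance corona_filter_proper : ProperFilter (corona_filter chi).
Proof.
apply: filter_from_proper.
  apply: filter_from_filter.
    exists 0; split=> [x|]; last exact: ev0.
    exact: lexx.
  move=> k l [k0 ck] [l0 cl]; exists (k + l).
    split=> [x|]; last by rewrite evD ck cl addr0.
    by rewrite -[leRHS]/(k x + l x) addr_ge0.
  move=> x; rewrite /= -[ltLHS]/(k x + l x) => kl; split=> /=; apply: le_lt_trans kl.
    by rewrite lerDl.
  by rewrite lerDr.
(* If no x satisfies k x < 1, then k is invertible although chi vanishes on it. *)
move=> k [k0 ck]; apply/set0P/eqP => kE.
have k1 x : 1 <= k x.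
  have : ~ (k x < 1) by move=> kx; have : set0 x by rewrite -kE.
  by move=> /negP; rewrite -real_leNgt ?ger0_real.
have : ev chi (k * MkBh (Bh_inv k1)) = 0 by rewrite evM ck mul0r.
rewrite (_ : k * _ = 1).
  by rewrite ev1 => /eqP; rewrite oner_eq0.
apply: val_inj; apply/funext => x /=.
by rewrite -[LHS]/(k x / k x) divff // gt_eqF // (lt_le_trans ltr01 (k1 x)).
Qed.

(** The test function is [|c - g|^2 / e^2]. It is a multiple of [g - c] times its conjugate, so
    [chi] kills it, and it is below [1] exactly where [|c - g| < e]. *)
Lemma corona_filter_cvg (g : Bh X) :
  (g : X -> R[i]^o) @ corona_filter chi --> ev chi g.
Proof.
apply/cvg_complexP => e e0; set c := ev chi g.
pose g' : Bh X := g - c *: (1 : Bh X).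
pose k : Bh X := (e ^- 2)%:C *: (g' * MkBh (Bh_conj g')).
have kE x : k x = (e ^- 2)%:C * `|c - g x| ^+ 2.
  rewrite distrC sqr_normc -[LHS]/((e ^- 2)%:C * (g' x * (g' x)^*%C)).
  by rewrite (_ : g' x = g x - c) // -[LHS]/(g x - c * 1) mulr1.
exists k.
  split=> [x|]; first by rewrite kE mulr_ge0 ?exprn_ge0 // ler0c invr_ge0 sqr_ge0.
  by rewrite evZ evM evB evZ ev1 mulr1 subrr mul0r mulr0.
move=> x; rewrite /mkset kE fmorphV mulrC ltr_pdivrMr ?mul1r; last first.
  by rewrite ltcR exprn_gt0.
rewrite rmorphXn ltr_pXn2r ?nnegrE ?normr_ge0 ?ler0c ?(ltW e0) // => kx.
exact: ltW kx.
Qed.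

Lemma corona_filter_infty : at_infinity (corona_filter chi) id.
Proof.
move=> B bB; exists (MkBh (indic_Bh bB)).
  split=> [x|]; first by rewrite /= ler0c indicE.
  apply: ev_B0; apply/B0_predP => e e0; exists B => // x Bx.
  by rewrite /= indicE memNset //= normr0 ler0c ltW.
move=> x /= x1 Bx; move: x1; rewrite indicE mem_set //=.
by rewrite ltxx.
Qed.

(** [A] contains [k < 1] for some [k] killed by [chi], and [A'] is the smaller set [k < 1 / 2]. Off
    a bounded set, slow oscillation keeps [k] from growing by more than [1 / 2] over a distance
    [r]. *)
Lemma corona_filter_thick (A : set X) : corona_filter chi A ->
  exists2 A', corona_filter chi A' & forall r : R, exists2 B, metric_bounded B &
    forall x x', A' x -> ~ B x -> mdist x x' <= r -> A x'.
Proof.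
move=> [k [k0 ck] kA]; exists [set x | (2%:R *: k) x < 1].
  exists (2%:R *: k) => //; split=> [x|]; last by rewrite evZ ck mulr0.
  by rewrite -[leRHS]/(2%:R * k x) mulr_ge0.
move=> r; have /Bh_predP[_ kso] := Bh_funP k.
have [||B bB kB] := kso (`|r| + 1) (2^-1); [by rewrite ltr_wpDl|by rewrite invr_gt0|].
exists (thicken B `|r|); first exact: thicken_bounded.
move=> x x'; rewrite /= -[X in X < _]/(2%:R * k x) => kx Bx xx'; apply: kA => /=.
have xx2 : mdist x x' <= `|r| by exact: le_trans xx' (ler_norm _).
have nBx : ~ B x by move=> Bx'; apply: Bx; exists x; rewrite ?mdistxx.
have nBx' : ~ B x' by move=> Bx'; apply: Bx; exists x'; rewrite // metric_sym.
have := kB x' x nBx' nBx; rewrite metric_sym (le_trans xx2) ?lerDl // => /(_ isT).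
have k12 : k x < 2^-1 by rewrite -[ltRHS]mul1r ltr_pdivlMr // mulrC.
move=> /(le_trans (real_ler_norm _)) kk.
have -> : k x' = k x + (k x' - k x) by rewrite addrC subrK.
have -> : (1 : R[i]) = 2^-1 + 2^-1 by rewrite [LHS]splitr mul1r.
apply: ltr_leD => //; rewrite fmorphV rmorph_nat in kk; apply: kk.
by rewrite rpredB // ger0_real.
Qed.

End characters.

Arguments corona_filter_cvg {R X} chi g [t] _.

(** * The light structure in terms of chains *)

Section light_metric.
Variables (R : realType) (X Y : metricType R) (f : X -> Y).
Local Notation LX := (metric_ls X).
Local Notation LY := (metric_ls Y).

Definition mball (y : Y) (s : R) : set Y := [set y' | mdist y y' <= s].

(** Link size and radius share one scale, which is harmless since both may be enlarged by
    [chained_widen]. *)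
Definition scale_chained (s : R) (x x' : X) :=
  chained [set U | (diam U <= s%:E)%E] (f @^-1` (mball (f x) s)) x x'.

Lemma chained_widen (s t : R) (A B : set X) x x' : s <= t -> A `<=` B ->
  chained [set U | (diam U <= s%:E)%E] A x x' ->
  chained [set U | (diam U <= t%:E)%E] B x x'.
Proof.
move=> st AB; apply: chained_sub => // U /= Us.
by apply: le_trans Us _; rewrite lee_fin.
Qed.

(** A set of diameter at most [N] lies in the [N]-ball about any of its points, and balls of a fixed
    radius are uniformly bounded; this trades the families [U] and [V] for one scale. *)
Lemma light_boundedP (F : set (set X)) : light_bounded LX LY f F <->
  exists2 s : R, 0 < s & forall B x x', F B -> B x -> B x' -> scale_chained s x x'.
Proof.
split=> [[U [V [[M M0 UM] [N N0 VN] FUV]]]|[s s0 Fs]]; last first.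
  exists [set U | (diam U <= s%:E)%E], [set mball y s | y in [set: Y]]; split.
  - by exists s.
  - exists (s + s); first by rewrite addr_gt0.
    move=> _ [y _ <-]; apply/diam_leP => a b ya yb.
    apply: le_trans (metric_triangle _ y _) _; apply: lerD yb.
    by rewrite metric_sym.
  - move=> B FB [x [_ [Bx _ _]]].
    exists [set x' | chained [set U | (diam U <= s%:E)%E]
        (f @^-1` mball (f x) s) x x'].
      exists (mball (f x) s); first by exists (f x).
      by exists x => //; rewrite /mball /= mdistxx ltW.
    by move=> x' Bx'; exact: Fs FB Bx Bx'.
exists (M + N); first exact: addr_gt0.
(* Equal points are treated apart because [refines] says nothing about one-point sets. *)
move=> B x x' FB Bx Bx'; have [<-|xx'] := pselect (x = x').
  by apply: chained_refl; rewrite /mball /= mdistxx ltW // addr_gt0.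
have [|_ [V' VV' [x0 _ <-]] BC] := FUV B FB; first by exists x, x'.
have /= cx := BC _ Bx; have /= cx' := BC _ Bx'.
have [_ V'x] := chained_in cx.
apply: chained_sub (chained_trans (chained_sym cx) cx').
  by move=> W /UM /= WM; apply: le_trans WM _; rewrite lee_fin lerDl ltW.
move=> z V'z; have /diam_leP := VN _ VV' => /(_ _ _ V'x V'z) xz.
by apply: le_trans xz _; rewrite lerDr ltW.
Qed.

Lemma uniformly_bounded_pairs (T : Type) (u v : T -> Y) (D : set T) :
  LY [set [set u t; v t] | t in D] ->
  exists K : R, forall t, D t -> mdist (u t) (v t) <= K.
Proof.
move=> [K K0 DK]; exists K => t Dt.
have /diam_leP : (diam [set u t; v t] <= K%:E)%E by apply: DK; exists t.
by apply; [left|right].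
Qed.

(** From left to right, [x] is chained to [g (f x)], then to [g (f x')], then to [x']. From right to
    left, any choice [g] of approximate preimages is a coarse inverse. *)
Lemma coarsely_monotoneP : coarsely_monotone f <->
  (exists K : R, forall y, exists x, mdist (f x) y <= K) /\
  (forall r : R, exists2 s, 0 < s &
    forall x x', mdist (f x) (f x') <= r -> scale_chained s x x').
Proof.
split=> [[_ [g [gls gf fg]]]|[[K fK] fs]].
  have [K fgK] := uniformly_bounded_pairs fg; split.
    by exists K => y; exists (g y); exact: fgK.
  move=> r.
  have /gls/light_boundedP[s s0 gs] : LY [set B | (diam B <= (`|r| + 1)%:E)%E].
    by exists (`|r| + 1) => //; rewrite ltr_wpDl.
  have /light_boundedP[t t0 gft] := gf.
  have rr : r <= `|r| + 1 by rewrite (le_trans (ler_norm _)) ?lerDl.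
  have K0 := normr_ge0 K; have r0 := normr_ge0 r; have KK := ler_norm K.
  (* The three chains lie over balls with centres at distance at most [0], [K], [r] from [f x] and
     radii [t], [s], [t]. *)
  set q := `|K| + s + t + (`|r| + 1).
  have sq : s <= q by rewrite /q; lra.
  have tq : t <= q by rewrite /q; lra.
  have Ksq : K + s <= q by rewrite /q; lra.
  have rtq : r + t <= q by rewrite /q; lra.
  exists q => [|x x' xx']; first by rewrite /q; lra.
  have c1 z : scale_chained t z (g (f z)).
    by apply: (gft [set g (f z); z]); [exists z|right|left].
  have c2 : scale_chained s (g (f x)) (g (f x')).
    apply: (gs (g @` [set f x; f x'])); [|by exists (f x) => //; left|
      by exists (f x') => //; right].
    exists [set f x; f x'] => //=; apply/diam_leP.
    have xr := le_trans xx' rr; have x'r := xr; rewrite metric_sym in x'r.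
    by move=> _ _ [->|->] [->|->]; rewrite ?mdistxx ?addr_ge0.
  apply: (@chained_trans _ _ _ _ (g (f x))).
    apply: chained_widen (c1 x) => // z; rewrite /mball /= => xz.
    exact: le_trans xz tq.
  apply: (@chained_trans _ _ _ _ (g (f x'))).
    apply: chained_widen c2 => // z; rewrite /mball /= => xz; apply: le_trans Ksq.
    apply: le_trans (metric_triangle _ (f (g (f x))) _) _; apply: lerD => //.
    by rewrite metric_sym; exact: (fgK (f x)).
  apply: chained_sym; apply: chained_widen (c1 x') => // z.
  rewrite /mball /= => xz; apply: le_trans rtq.
  by apply: le_trans (metric_triangle _ (f x') _) _; exact: lerD.
have [g gK] := choice fK; split.
  move=> F [U [V [_ LV FUV]]]; apply: (ls_refines LV) => _ [B FB <-].
  move=> [_ [_ [[x Bx <-] [x' Bx' <-] fxx']]].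
  have [|_ [W VW [x0 _ <-]] BW] := FUV B FB.
    by exists x, x'; split => // xx'; apply: fxx'; rewrite xx'.
  exists W => // _ [z Bz <-].
  by have /= cz := BW z Bz; have [] := chained_in cz.
exists g; split.
- move=> F [M M0 FM]; apply/light_boundedP.
  have [s s0 fss] := fs (K + (M + K)); exists s => // D a a' [B FB <-].
  move=> [y By <-] [y' By' <-]; apply: fss.
  apply: le_trans (metric_triangle _ y _) _; apply: lerD => //.
  apply: le_trans (metric_triangle _ y' _) _; apply: lerD.
    by have /diam_leP := FM B FB; apply.
  by rewrite metric_sym.
- apply/light_boundedP; have [s s0 fss] := fs `|K|.
  have KK := ler_norm K; exists s => // D a a' [x _ <-] [->|->] [->|->];
    apply: fss; rewrite ?mdistxx // ?[mdist (f x) _]metric_sym;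
    exact: le_trans (gK _) _.
- exists (`|K| + 1); first by rewrite ltr_wpDl.
  move=> _ [y _ <-]; apply/diam_leP.
  have KK : mdist (f (g y)) y <= `|K| + 1.
    by rewrite (le_trans (gK y)) // (le_trans (ler_norm _)) ?lerDl.
  by move=> _ _ [->|->] [->|->] /=; rewrite ?mdistxx ?addr_ge0 // metric_sym.
Qed.

End light_metric.

(** * The induced map and corona filters *)

Section corona_maps.
Variables (R : realType) (X Y : metricType R) (f : X -> Y).
Hypothesis cf : coarse_map f.

Lemma ev_higson_map (chi : higson_corona X) (g : Bh Y) :
  ev (higson_map cf chi) g = ev chi (Bh_pullback cf g).
Proof. by rewrite /ev -(higson_pullback_pi cf g). Qed.

Lemma corona_filter_preimage (chi : higson_corona X) (A : set Y) :
  corona_filter (higson_map cf chi) A -> corona_filter chi (f @^-1` A).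
Proof.
move=> [k [k0 ck] kA]; exists (Bh_pullback cf k).
  by split=> [x|]; [exact: k0|rewrite -ev_higson_map].
by move=> x /= kx; exact: kA.
Qed.

End corona_maps.

(** * The topology of the corona *)

Section ultrafilters_at_infinity.
Variables (R : realType) (X : metricType R).
Local Notation Q := (higson_algebra X).

Lemma B0_cvg (T : Type) (F : set_system T) {FF : Filter F} (u : T -> X)
    (g : Bh X) : at_infinity F u -> g \in B0_pred X ->
  (fun t => g (u t) : R[i]^o) @ F --> (0 : R[i]^o).
Proof.
move=> Fu /B0_predP g0; apply/cvg_complexP => e /g0[B bB gB].
by apply: filterS (Fu B bB) => t /= /gB; rewrite sub0r normrN.
Qed.

(** Bounded functions converge along an ultrafilter, and limits respect sums and products. Since [u]
    goes to infinity the limit kills [B0_pred], so it descends to the quotient. *)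
Lemma ultra_character (T : Type) (F : set_system T) (u : T -> X) :
  UltraFilter F -> at_infinity F u ->
  exists chi : higson_corona X, forall g : Bh X,
    (fun t => g (u t) : R[i]^o) @ F --> ev chi g.
Proof.
move=> FU Fu; have FP : ProperFilter F by exact: ultra_proper.
have /choice[l lP] (g : Bh X) : exists c : R[i]^o,
    (fun t => g (u t) : R[i]^o) @ F --> c.
  have /Bh_predP[[M gM] _] := Bh_funP g.
  by apply: (@ultra_bounded_cvg _ _ _ _ M) => // t; exact: gM.
pose chi0 (a : Q) : R[i]^o := l (repr a).
have lB0 g : g \in B0_pred X -> l g = 0.
  by move=> g0; apply: complex_cvg_unique (lP g) (B0_cvg Fu g0).
have lD g h : l (g + h) = l g + l h.
  by apply: complex_cvg_unique (lP _) _; exact: cvgD (lP g) (lP h).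
have lM g h : l (g * h) = l g * l h.
  by apply: complex_cvg_unique (lP _) _; exact: cvgM (lP g) (lP h).
have lcst c : l (MkBh (cst_Bh X c)) = c.
  by apply: complex_cvg_unique (lP _) _; exact: cvg_cst.
have lZ c g : l (c *: g) = c * l g.
  rewrite -{2}(lcst c) -lM; congr l; exact: val_inj.
have chi0_pi g : chi0 (\pi_Q g) = l g.
  have gg : repr (\pi_Q g) - g \in B0_pred X by apply/higson_eqP; rewrite reprK.
  by rewrite /chi0 -[repr _](subrK g) lD lB0 // add0r.
have chiP : higson_characters X chi0.
  split=> [c a b|].
    have [g ->] := higson_piP a; have [h ->] := higson_piP b.
    by rewrite -(pi_higsonZ c g) -(pi_higsonD (c *: g) h) !chi0_pi lD lZ.
  split=> [|a b].
    rewrite -[LHS]/(chi0 (\pi_Q 1)) chi0_pi -[RHS](lcst 1).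
    by congr l; exact: val_inj.
  have [g ->] := higson_piP a; have [h ->] := higson_piP b.
  by rewrite -(pi_higsonM g h) !chi0_pi lM.
exists (SigSub (mem_set chiP)) => g.
by rewrite -[ev _ g]/(chi0 (\pi_Q g)) chi0_pi; exact: lP.
Qed.

(** The order on [R[i]] compares only numbers with equal imaginary parts, so such an [h] is
    real-valued. *)
Definition unit_valued (h : Bh X) := forall x, 0 <= h x <= 1.

(** Complete regularity of the corona, witnessed by the algebra. The sets [U] with this property
    form a filter, so by definition of the product topology it suffices to treat conditions on one
    coordinate. *)
Lemma corona_nbhs (chi : higson_corona X) (U : set (higson_corona X)) :
  nbhs chi U -> exists h : Bh X, [/\ unit_valued h, ev chi h = 0 &
    forall theta, ~ U theta -> ev theta h = 1].
Proof.
pose M : set_system (higson_corona X) :=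
  [set U | exists h : Bh X, [/\ unit_valued h, ev chi h = 0 &
    forall theta, ~ U theta -> ev theta h = 1]].
have FM : Filter M.
  split.
  - by exists 0; split=> [x||theta]; [rewrite lexx ler01|exact: ev0|case].
  - move=> U1 U2 [h1 [h1u h10 h11]] [h2 [h2u h20 h21]].
    (* This is [1 - (1 - h1) * (1 - h2)], equal to [1] as soon as [h1] or [h2] is. *)
    exists (h1 + h2 - h1 * h2); split=> [x||theta].
    + have -> : (h1 + h2 - h1 * h2) x = 1 - (1 - h1 x) * (1 - h2 x).
        rewrite -[LHS]/(h1 x + h2 x - h1 x * h2 x); ring.
      have /andP[a0 a1] := h1u x; have /andP[b0 b1] := h2u x.
      by rewrite subr_ge0 mulr_ile1 ?gerBl ?mulr_ge0 ?subr_ge0.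
    + by rewrite evB evD evM h10 h20 mul0r addr0 subr0.
    + move=> /not_andP[/h11|/h21] e1; rewrite evB evD evM e1.
        by rewrite mul1r addrK.
      by rewrite mulr1 addrAC subrr add0r.
  - move=> U1 U2 U12 [h [hu h0 h1]]; exists h; split=> // theta nU.
    by apply: h1 => /U12.
suff : M --> chi by apply.
suff Mval : (set_val : _ -> {ptws Q -> R[i]^o}) @ M --> set_val chi.
  move=> W [?/= [[V oV <-]]] /= Vchi /filterS; apply.
  by apply: Mval; exact: open_nbhs_nbhs.
apply/cvg_sup => a W [?/= [[V oV <-]]] /= Vchi /filterS; apply.
have [g ga] := higson_piP a; pose c := ev chi g.
have /nbhs_ballP[e /= e0 ceV] : nbhs c V.
  by rewrite /c /ev -ga; exact: open_nbhs_nbhs.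
pose d := complex.Re e.
have ed : e = d%:C.
  move: e0; rewrite ltcE /= => /andP[/eqP ie _].
  by rewrite [LHS]complexE ie rmorph0 mulr0 addr0.
have d0 : 0 < d by move: e0; rewrite ed ltcR.
(* The distance from [g x] to the value [c] at [chi], rescaled by the radius of a ball inside [V]
   and truncated. *)
pose h x : R := Num.min 1 (Normc.normc (g x - c) / d).
have n0 (z : R[i]) : 0 <= Normc.normc z by rewrite -ler0c; exact: (normr_ge0 z).
have h01 x : 0 <= h x <= 1.
  by rewrite le_min ler01 divr_ge0 ?(ltW d0) //= ge_min lexx.
have hB : (fun x => (h x)%:C) \in Bh_pred X.
  have /Bh_predP[_ gso] := Bh_funP g.
  apply: (@real_BhP _ _ _ 1) => [x|r s r0 s0].
    by have /andP[? ?] := h01 x; rewrite ger0_norm.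
  have [B bB gB] := gso r (s * d) r0 (mulr_gt0 s0 d0); exists B => // x x' Bx Bx' xx'.
  have nn : `|Normc.normc (g x - c) - Normc.normc (g x' - c)| <= s * d.
    rewrite -lecR; apply: le_trans (gB _ _ Bx Bx' xx').
    have -> : g x - g x' = (g x - c) - (g x' - c) by rewrite opprB addrA subrK.
    by rewrite -normc_real rmorphB; exact: (ler_dist_dist (g x - c) (g x' - c)).
  have : `|Normc.normc (g x - c) / d - Normc.normc (g x' - c) / d| <= s.
    by rewrite -mulrBl normrM normfV (gtr0_norm d0) ler_pdivrMr.
  rewrite /h; set p := _ / d; set q := _ / d; rewrite !ler_norml.
  by rewrite /Num.min; case: ifP => p1; case: ifP => q1; lra.
exists (MkBh hB); split=> [x||theta nV].
- by rewrite /= ler0c lecR.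
- rewrite -[RHS]/((0 : R)%:C : R[i]^o).
  apply: complex_cvg_unique (corona_filter_cvg chi (MkBh hB)) _.
  apply/cvg_realP => s s0.
  have /cvg_complexP := corona_filter_cvg chi g.
  move=> /(_ _ (mulr_gt0 s0 d0)); apply: filterS => x.
  rewrite distrC -[X in X <= _]/(Normc.normc (g x - c))%:C lecR.
  rewrite -ler_pdivrMr // sub0r normrN => gx.
  have /andP[h0 _] := h01 x.
  by rewrite ger0_norm // ge_min gx orbT.
- rewrite -[RHS]/((1 : R)%:C : R[i]^o).
  apply: complex_cvg_unique (corona_filter_cvg theta (MkBh hB)) _.
  apply/cvg_realP => s s0.
  have /cvg_complexP := corona_filter_cvg theta g.
  move=> /(_ _ (mulr_gt0 s0 d0)); apply: filterS => x gx.
  have far : d <= Normc.normc (c - ev theta g).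
    rewrite leNgt; apply/negP => ct; apply: nV; rewrite /= ga.
    by apply: ceV; rewrite -ball_normE /= ed -/(ev theta g) ltcR.
  have tri : `|c - ev theta g| <= `|g x - c| + `|ev theta g - g x|.
    by rewrite (distrC (g x)) (distrC (ev theta g) (g x)) ler_distD.
  have dx : d <= Normc.normc (g x - c) + s * d.
    rewrite -lecR rmorphD; apply: le_trans (le_trans tri _); first by rewrite lecR.
    by apply: lerD gx; exact: lexx.
  have : 1 - s <= Normc.normc (g x - c) / d.
    by rewrite ler_pdivlMr // mulrBl mul1r lerBlDr.
  have /andP[_ h1] := h01 x; rewrite ger0_norm ?subr_ge0 //.
  by rewrite /h /Num.min; case: ifP => _ ps; lra.
Qed.

End ultrafilters_at_infinity.

(** * Limits along close maps, and values of characters *)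

Section close_maps.
Variables (R : realType) (X : metricType R) (T : Type) (F : set_system T).
Context {FF : Filter F}.
Variables (u v : T -> X) (K : R).
Hypothesis uv : forall t, mdist (u t) (v t) <= K.
Hypothesis Fu : at_infinity F u.

Lemma at_infinity_close : at_infinity F v.
Proof.
move=> B /(@thicken_bounded _ _ _ K)/Fu; apply: filterS => t /= nB Bv; apply: nB.
by exists (v t) => //; rewrite metric_sym.
Qed.

Lemma Bh_cvg_close (g : Bh X) (c : R[i]^o) :
  (fun t => g (u t) : R[i]^o) @ F --> c -> (fun t => g (v t) : R[i]^o) @ F --> c.
Proof.
move=> /cvg_complexP guc; apply/cvg_complexP => e e0.
have e2 : 0 < e / 2 by rewrite divr_gt0.
have /Bh_predP[_ gso] := Bh_funP g.
have [|B bB gB] := gso (`|K| + 1) (e / 2) _ e2; first by rewrite ltr_wpDl.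
near=> t.
rewrite -(subrK (g (u t)) c) -addrA [e]splitr rmorphD.
apply: le_trans (ler_normD _ _) _; apply: lerD; first by near: t; exact: guc.
apply: gB.
- by near: t; exact: Fu.
- by near: t; exact: at_infinity_close.
- by rewrite (le_trans (uv t)) // (le_trans (ler_norm K)) // lerDl.
Unshelve. all: by end_near. Qed.

End close_maps.

Lemma cvg_Re (R : realType) (T : Type) (F : set_system T) {FF : Filter F}
    (g : T -> R[i]^o) (t e : R) : g @ F --> (t%:C : R[i]^o) -> 0 < e ->
  F [set x | `|t - complex.Re (g x)| <= e].
Proof.
move=> /cvg_complexP gt e0; apply: filterS (gt e e0) => x /= gx.
rewrite -lecR; apply: le_trans gx; apply: le_trans (normc_ge_Re _).
by rewrite lecR; case: (g x) => a b; rewrite /= lexx.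
Qed.

Lemma ev_near_cst (R : realType) (X : metricType R) (chi : higson_corona X)
    (g : Bh X) (c : R[i]^o) : corona_filter chi [set x | g x = c] -> ev chi g = c.
Proof.
move=> gc; apply: complex_cvg_unique (corona_filter_cvg chi g) _.
exact: cvg_near_cst gc.
Qed.

Lemma unit_valued_Re (R : realType) (X : metricType R) (h : Bh X) x :
  unit_valued h -> h x = (complex.Re (h x))%:C /\ 0 <= complex.Re (h x) <= 1.
Proof.
move=> /(_ x); rewrite !lecE /= => /andP[/andP[/eqP h0 ->] /andP[_ ->]].
by split=> //; rewrite [LHS]complexE h0 rmorph0 mulr0 addr0.
Qed.

(** * Coarsely monotone maps induce monotone maps *)

Section light_to_monotone.
Variables (R : realType) (X Y : metricType R) (f : X -> Y).
Hypothesis cf : coarse_map f.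

(** A choice [g] of approximate preimages pushes an ultrafilter finer than the corona filter of
    [eta] to [X]; the limit there is sent to [eta] because [f \o g] is close to the identity. *)
Lemma coarsely_surj_higson_map :
  (exists K : R, forall y, exists x, mdist (f x) y <= K) ->
  set_surj [set: higson_corona X] [set: higson_corona Y] (higson_map cf).
Proof.
move=> [K /choice[g gK]] eta _.
have [G [GU etaG]] := ultraFilterLemma (corona_filter_proper eta).
have GP : ProperFilter G by exact: ultra_proper.
have gK' y : mdist (id y) ((f \o g) y) <= K by rewrite metric_sym; exact: gK.
have Gid : at_infinity G (@id Y).
  by move=> B /(corona_filter_infty eta)/etaG.
have Gfg := at_infinity_close gK' Gid.
have Gg : at_infinity G g.
  move=> B /(image_bounded cf.1)/Gfg; apply: filterS => y /= nB Bg.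
  by apply: nB; exists (g y).
have [chi chiG] := ultra_character GU Gg.
exists chi => //; apply: corona_ext => k; rewrite ev_higson_map.
apply: complex_cvg_unique (chiG _) _.
apply: (Bh_cvg_close gK' Gid) => U /(corona_filter_cvg eta k).
exact: etaG.
Qed.

Variable eta : higson_corona Y.
Let Z := higson_map cf @^-1` [set eta].

(** Images of bounded sets are bounded, so such an [F] goes to infinity and defines a character; its
    image and [eta] are both limits along the image of [F]. *)
Lemma ultra_fibre (F : set_system X) : UltraFilter F ->
  (forall A, corona_filter eta A -> F (f @^-1` A)) ->
  exists2 theta, Z theta & forall g : Bh X, (g : X -> R[i]^o) @ F --> ev theta g.
Proof.
move=> FU Feta; have FP : ProperFilter F by exact: ultra_proper.
have Fid : at_infinity F (@id X).
  move=> B /(image_bounded cf.1)/(corona_filter_infty eta)/Feta.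
  by apply: filterS => x /= nB Bx; apply: nB; exists x.
have [theta thetaF] := ultra_character FU Fid; exists theta => //.
apply: corona_ext => k; rewrite ev_higson_map.
apply: complex_cvg_unique (thetaF _) _ => U /(corona_filter_cvg eta k)/Feta.
exact.
Qed.

Definition tends_to1_on (W : set (higson_corona X)) : set (Bh X) :=
  [set h | unit_valued h /\ forall theta, W theta -> ev theta h = 1].

Let tends_to1_on1 W : tends_to1_on W 1.
Proof. by split=> [x|theta _]; [rewrite lexx ler01|exact: ev1]. Qed.

Let tends_to1_onM W h k :
  tends_to1_on W h -> tends_to1_on W k -> tends_to1_on W (h * k).
Proof.
move=> [hu h1] [ku k1]; split=> [x|theta Wt]; last by rewrite evM h1 // k1 // mulr1.
have /andP[a0 a1] := hu x; have /andP[b0 b1] := ku x.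
by rewrite -[(h * k) x]/(h x * k x) mulr_ge0 ?mulr_ile1.
Qed.

Let Re_mul_ge (h k : Bh X) x (c : R) : unit_valued h -> unit_valued k ->
  c <= complex.Re ((h * k) x) -> c <= complex.Re (h x) /\ c <= complex.Re (k x).
Proof.
move=> hu ku; have [hE /andP[a0 a1]] := unit_valued_Re x hu.
have [kE /andP[b0 b1]] := unit_valued_Re x ku.
rewrite -[(h * k) x]/(h x * k x) hE kE -rmorphM /= => chk.
by split; apply: le_trans chk _; [rewrite ler_piMr|rewrite ler_piMl].
Qed.

(* Both steps are compactness arguments: an ultrafilter witnessing failure would
   converge to a point of the fibre. Closure of tends_to1_on under products makes
   the witnessing sets a filter base. *)
Lemma fibre_separation (B U C : set (higson_corona X)) : open U -> closed C ->
    B = Z `&` U -> B = Z `&` C ->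
  exists A h1 h2, [/\ corona_filter eta A, tends_to1_on (Z `\` B) h1,
    tends_to1_on B h2 & forall x, A (f x) ->
      complex.Re (h1 x) < 2^-1 /\ ~ (complex.Re (h2 x) <= 3 / 4) \/
      complex.Re (h2 x) < 2^-1 /\ ~ (complex.Re (h1 x) <= 3 / 4)].
Proof.
move=> oU cC BU BC; pose W1 := Z `\` B.
have [A [h1 [h2 [etaA h1W h2W Ah]]]] : exists A h1 h2, [/\ corona_filter eta A,
    tends_to1_on W1 h1, tends_to1_on B h2 & forall x, A (f x) ->
    complex.Re (h1 x) < 2^-1 \/ complex.Re (h2 x) < 2^-1].
  apply: contrapT => nA.
  pose D : set (set Y * (Bh X * Bh X)) := [set i | [/\ corona_filter eta i.1,
    tends_to1_on W1 i.2.1 & tends_to1_on B i.2.2]].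
  pose V (i : set Y * (Bh X * Bh X)) : set X := [set x | [/\ i.1 (f x),
    2^-1 <= complex.Re (i.2.1 x) & 2^-1 <= complex.Re (i.2.2 x)]].
  have FV : Filter (filter_from D V).
    apply: filter_from_filter.
      by exists (setT, (1, 1)); split=> //; exact: filterT.
    move=> [A [h1 h2]] [A' [h1' h2']] [/= a1 a2 a3] [/= b1 b2 b3].
    exists (A `&` A', (h1 * h1', h2 * h2')).
      by split; [exact: filterI|exact: tends_to1_onM|exact: tends_to1_onM].
    move=> x [/= [Ax A'x] /(Re_mul_ge a2.1 b2.1)[? ?] /(Re_mul_ge a3.1 b3.1)[? ?]].
    by split; split.
  have FP : ProperFilter (filter_from D V).
    apply: filter_from_proper => // -[A [h1 h2]] [/= a1 a2 a3].
    apply/set0P/eqP => V0; apply: nA; exists A, h1, h2; split=> // x Ax.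
    apply: contrapT => /not_orP[/negP n1 /negP n2].
    have : set0 x by rewrite -V0; split; rewrite //= leNgt.
    by [].
  have [F [FU DF]] := ultraFilterLemma FP.
  have FPF : ProperFilter F by exact: ultra_proper.
  have [|theta Ztheta thetaF] := @ultra_fibre F FU.
    move=> A etaA; apply: DF; exists (A, (1, 1)); first by split.
    by move=> x [].
  have absurd (h : Bh X) : ev theta h = 0 ->
      F [set x | 2^-1 <= complex.Re (h x)] -> False.
    move=> h0 Fh; have := thetaF h; rewrite h0 => /(@cvg_Re _ _ _ _ _ 0).
    have q : 0 < 4^-1 :> R by rewrite invr_gt0.
    move=> /(_ _ q) Fh'; have [x [/= Fx]] := filter_ex (filterI Fh Fh').
    by rewrite sub0r normrN ler_norml => /andP[]; lra.
  (* If [theta] is in [B], a function vanishing at [theta] and equal to [1] off [U] is an admissible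
     [h1], yet it is at least [1 / 2] along [F]. Otherwise the complement of [C] gives an admissible
     [h2]. *)
  have [Bt|nBt] := pselect (B theta).
    have Ut : U theta by move: Bt; rewrite BU => -[].
    have [h [hu h0 h1]] := corona_nbhs (open_nbhs_nbhs (conj oU Ut)).
    apply: (absurd h) => //; apply: DF; exists (setT, (h, 1)); last by move=> x [].
    split=> //=; first exact: filterT.
    by split=> // t [Zt nBt]; apply: h1 => Ut'; apply: nBt; rewrite BU.
  have Ct : (~` C) theta by move=> Ct; apply: nBt; rewrite BC.
  have [h [hu h0 h1]] := corona_nbhs (open_nbhs_nbhs (conj (closed_openC cC) Ct)).
  apply: (absurd h) => //; apply: DF; exists (setT, (1, h)); last by move=> x [].
  split=> //=; first exact: filterT.
  by split=> // t; rewrite BC => -[_ Ct']; apply: h1; exact.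
(* One of the now fixed [h1], [h2] is [1] at each point of the fibre, which excludes that both stay
   at most [3 / 4]. *)
have [A' etaA' A'h] : exists2 A', corona_filter eta A' & forall x, A' (f x) ->
    ~ (complex.Re (h1 x) <= 3 / 4 /\ complex.Re (h2 x) <= 3 / 4).
  apply: contrapT => nA'.
  pose V (A : set Y) : set X := [set x | [/\ A (f x),
    complex.Re (h1 x) <= 3 / 4 & complex.Re (h2 x) <= 3 / 4]].
  have FV : Filter (filter_from (corona_filter eta) V).
    apply: filter_from_filter; first by exists setT; exact: filterT.
    move=> A1 A2 a1 a2; exists (A1 `&` A2); first exact: filterI.
    by move=> x [[] *]; split.
  have FP : ProperFilter (filter_from (corona_filter eta) V).
    apply: filter_from_proper => // A1 a1; apply/set0P/eqP => V0; apply: nA'.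
    by exists A1 => // x A1x [n1 n2]; have : set0 x by rewrite -V0.
  have [F [FU DF]] := ultraFilterLemma FP.
  have FPF : ProperFilter F by exact: ultra_proper.
  have [|theta Ztheta thetaF] := @ultra_fibre F FU.
    by move=> A1 etaA1; apply: DF; exists A1 => // x [].
  have absurd (h : Bh X) : ev theta h = 1 ->
      F [set x | complex.Re (h x) <= 3 / 4] -> False.
    move=> e1 Fh; have := thetaF h; rewrite e1 => /(@cvg_Re _ _ _ _ _ 1).
    have q : 0 < 8^-1 :> R by rewrite invr_gt0.
    move=> /(_ _ q) Fh'; have [x [/= Fx]] := filter_ex (filterI Fh Fh').
    by rewrite ler_norml => /andP[]; lra.
  have [Bt|nBt] := pselect (B theta).
    apply: (absurd h2); first exact: h2W.2.
    by apply: DF; exists setT; [exact: filterT|move=> x []].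
  apply: (absurd h1); first exact: h1W.2.
  by apply: DF; exists setT; [exact: filterT|move=> x []].
exists (A `&` A'), h1, h2; split=> //; first exact: filterI.
move=> x [/Ah[a|a] /A'h a']; [left|right]; split=> // b; apply: a'.
  by split=> //; lra.
by split=> //; lra.
Qed.

(** Over [A] the real part of [h1] avoids the interval from [1 / 2] to [3 / 4]. It cannot cross it
    along a chain far out, each link changing it by at most [1 / 8]. So the images [P], [Q] of the
    two level sets are separated by some [psi], which would be both [0] and [1] at [eta]. *)
Lemma connected_fibre :
  (forall r : R, exists2 s, 0 < s &
    forall x x', mdist (f x) (f x') <= r -> scale_chained f s x x') ->
  connected Z.
Proof.
move=> fs B [chi Bchi] [U oU BU] [C cC BC]; rewrite eqEsubset.
split=> [theta|chi' Zchi']; first by rewrite BU => -[].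
apply: contrapT => nBchi'.
have [A [h1 [h2 [etaA h1W h2W Ah]]]] := fibre_separation oU cC BU BC.
have [A' etaA' A'A] := corona_filter_thick etaA.
pose P := f @` [set x | A' (f x) /\ complex.Re (h1 x) < 2^-1].
pose Q := f @` [set x | A' (f x) /\ ~ (complex.Re (h1 x) <= 3 / 4)].
have PQ : asymptotically_disjoint P Q.
  move=> r; have [s s0 rs] := fs (r + r).
  have /Bh_predP[_ h1so] := Bh_funP h1.
  have q : 0 < 8^-1 :> R by rewrite invr_gt0.
  have [B1 bB1 h1B1] := h1so s 8^-1 s0 q.
  have [B2 bB2 A'B2] := A'A s.
  (* If [y] is outside this set, the chain from [x] stays over [A] and off [B1], because its image
     remains within [s] of [f x]. *)
  have : metric_bounded (thicken (thicken (f @` B1) s `|` B2) r).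
    apply: thicken_bounded; apply: metric_boundedU => //.
    by apply: thicken_bounded; exact: image_bounded cf.1 bB1.
  apply: metric_bounded_sub => y [[_ [x [A'x h1x] <-] xy] [_ [x' [A'x' h1x'] <-] x'y]].
  apply: contrapT => ny.
  have nB1 : ~ thicken (f @` B1) s (f x) by move=> ?; apply: ny; exists (f x) => //; left.
  have nB2 : ~ B2 (f x) by move=> ?; apply: ny; exists (f x) => //; right.
  have [|n [z [z0 zn zA zU]]] := rs x x'.
    by apply: le_trans (metric_triangle _ y _) _; rewrite lerD // metric_sym.
  have Az i : (i <= n)%N -> A (f (z i)) by move=> /zA; exact: A'B2.
  have zB1 i : (i <= n)%N -> ~ B1 (z i).
    move=> /zA; rewrite /mball /= => xz B1z; apply: nB1.
    by exists (f (z i)); [exists (z i)|rewrite metric_sym].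
  have small i : (i <= n)%N -> complex.Re (h1 (z i)) < 2^-1.
    elim: i => [|i IH] i_n; first by rewrite z0.
    have := IH (ltnW i_n) => h1i; have [W Ws [Wi Wi1]] := zU i i_n.
    have : mdist (z i) (z i.+1) <= s by move/diam_leP: Ws; apply.
    move=> /(h1B1 _ _ (zB1 _ (ltnW i_n)) (zB1 _ i_n)).
    move=> /(le_trans (normc_ge_Re _)); rewrite lecR => hh.
    have {hh} : `|complex.Re (h1 (z i)) - complex.Re (h1 (z i.+1))| <= 8^-1.
      by move: hh; case: (h1 (z i)) => ? ?; case: (h1 (z i.+1)).
    rewrite ler_norml => /andP[hi _].
    have [[//]|[_ big]] := Ah _ (Az _ i_n).
    by exfalso; apply: big; lra.
  by apply: h1x'; have := small n (leqnn n); rewrite zn; lra.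
have [k kB [k01 kP [B3 bB3 kQ]]] := Urysohn_Bh PQ.
pose psi := MkBh kB.
(* Near [chi], a point of [B], [h2] is at least [3 / 4], so [h1] is low and [f] takes values in [P].
   Near [chi'] the roles are exchanged. *)
have psi0 : ev eta psi = 0.
  have mchi : higson_map cf chi = eta by move: Bchi; rewrite BU => -[].
  rewrite -mchi ev_higson_map; apply: ev_near_cst.
  have etaA'chi : corona_filter chi (f @^-1` A').
    by apply: (@corona_filter_preimage _ _ _ _ cf); rewrite mchi.
  have etaAchi : corona_filter chi (f @^-1` A).
    by apply: (@corona_filter_preimage _ _ _ _ cf); rewrite mchi.
  have q : 0 < 4^-1 :> R by rewrite invr_gt0.
  have := corona_filter_cvg chi h2; rewrite (h2W.2 _ Bchi).
  move=> /(@cvg_Re _ _ _ _ _ 1)/(_ q) near1.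
  apply: filterS (filterI (filterI etaA'chi etaAchi) near1) => x [[/= A'x Ax]].
  rewrite ler_norml => /andP[_ h2x].
  have [[h1x _]|[h2x' _]] := Ah x Ax; last first.
    by have : (0 : R) < 0; [lra|rewrite ltxx].
  by rewrite kP //; exists x.
have psi1 : ev eta psi = 1.
  have mchi' : higson_map cf chi' = eta by exact: Zchi'.
  rewrite -mchi' ev_higson_map; apply: ev_near_cst.
  have etaA'chi : corona_filter chi' (f @^-1` A').
    by apply: (@corona_filter_preimage _ _ _ _ cf); rewrite mchi'.
  have etaAchi : corona_filter chi' (f @^-1` A).
    by apply: (@corona_filter_preimage _ _ _ _ cf); rewrite mchi'.
  have etaB3 : corona_filter chi' (f @^-1` (~` B3)).
    apply: (@corona_filter_preimage _ _ _ _ cf); exact: corona_filter_infty.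
  have q : 0 < 4^-1 :> R by rewrite invr_gt0.
  have := corona_filter_cvg chi' h1; rewrite (h1W.2 _ (conj Zchi' nBchi')).
  move=> /(@cvg_Re _ _ _ _ _ 1)/(_ q) near1.
  apply: filterS (filterI (filterI etaB3 (filterI etaA'chi etaAchi)) near1).
  move=> x [[/= nB3 [A'x Ax]]]; rewrite ler_norml => /andP[_ h1x].
  have [[h1x' _]|[_ h1x']] := Ah x Ax.
    by have : (0 : R) < 0; [lra|rewrite ltxx].
  by rewrite kQ //; exists x.
by have : (1 : R[i]) = 0; [rewrite -psi1 -psi0|move/eqP; rewrite oner_eq0].
Qed.

End light_to_monotone.

Lemma exists_nat_gt (R : realType) (r : R) : exists N : nat, r < N%:R.
Proof.
exists (Num.bound `|r|).
exact: le_lt_trans (ler_norm r) (archi_boundP (normr_ge0 r)).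
Qed.

(** * Monotone induced maps come from coarsely monotone maps *)

Section monotone_to_light.
Variables (R : realType) (X Y : metricType R) (f : X -> Y).
Hypothesis cf : coarse_map f.
Variable x0 : X.
Let o := f x0.

Lemma seq_bounded (y : nat -> Y) (N : nat) :
  metric_bounded [set y n | n in [set n | (n < N)%N]].
Proof.
elim: N => [|N IH].
  by apply: metric_bounded_sub (@metric_bounded0 R Y) => z [n].
have yN : metric_bounded [set y N].
  by apply/(metric_boundedP (y N)); exists 0 => _ ->; rewrite mdistxx.
apply: metric_bounded_sub (metric_boundedU IH yN) => _ [n /= nN <-].
move: nN; rewrite ltnS leq_eqVlt => /orP[/eqP ->|nN]; first by right.
by left; exists n.
Qed.

(** Otherwise there are [y n] farther than [n] from the range of [f]. A function vanishing on the
    range and equal to [1] along [y] near infinity pulls back to [0], so a limit of [y] is not in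
    the image. *)
Lemma higson_map_surj_coarse :
  set_surj [set: higson_corona X] [set: higson_corona Y] (higson_map cf) ->
  exists K : R, forall y, exists x, mdist (f x) y <= K.
Proof.
move=> fsurj; apply: contrapT => nK.
have /choice[y yn] (n : nat) : exists y, forall x, n%:R < mdist (f x) y.
  apply: contrapT => ny; apply: nK; exists n%:R => z; apply: contrapT => nz.
  by apply: ny; exists z => x; rewrite ltNge; apply/negP => xz; apply: nz; exists x.
have fy : asymptotically_disjoint (range f) (range y).
  move=> r; have [N rN] := exists_nat_gt (r + r).
  apply: metric_bounded_sub (thicken_bounded r (seq_bounded y N)).
  move=> z [[_ [x _ <-] xz] [_ [n _ <-] nz]]; exists (y n) => //; exists n => //=.
  rewrite -(ltr_nat R); apply: le_lt_trans rN; apply: le_trans (ltW (yn n x)) _.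
  by apply: le_trans (metric_triangle _ z _) _; rewrite lerD // metric_sym.
have [h hB [_ h0 [B bB h1]]] := Urysohn_Bh fy; pose H := MkBh hB.
(* A free ultrafilter on the integers. *)
have [G [GU ooG]] := @ultraFilterLemma nat \oo _.
have GP : ProperFilter G by exact: ultra_proper.
have Gy : at_infinity G y.
  move=> D /(metric_boundedP o)[M DM]; have [N MN] := exists_nat_gt M.
  apply: filterS (ooG _ (nbhs_infty_ge N)) => n /= Nn /DM.
  apply/negP; rewrite -ltNge; apply: lt_trans (yn n x0).
  by apply: lt_le_trans MN _; rewrite ler_nat.
have [eta etaG] := ultra_character GU Gy.
have [chi _ chieta] := fsurj eta I.
have eta1 : ev eta H = 1.
  apply: complex_cvg_unique (etaG H) _; apply: cvg_near_cst.
  by apply: filterS (Gy B bB) => n /= nB; rewrite h1 //; exists n.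
have : ev eta H = 0.
  rewrite -chieta ev_higson_map; apply: ev_near_cst.
  by apply: filterE => x /=; rewrite h0 //; exists x.
by rewrite eta1 => /eqP; rewrite oner_eq0.
Qed.

Section bad_pairs.
Variable r : R.
Hypothesis bad : forall s : R, 0 < s ->
  exists x x', mdist (f x) (f x') <= r /\ ~ scale_chained f s x x'.

(** A pair with close images near [o] lies in a bounded set, hence forms a single link at a large
    scale. So a pair that is bad at that scale lies far out. *)
Lemma far_bad_pair (t : R) : 0 < t -> exists x x', [/\ mdist (f x) (f x') <= r,
  ~ scale_chained f t x x' & 4 * t < mdist o (f x)].
Proof.
move=> t0; pose B := f @^-1` mball o (4 * t + `|r|).
have [M /diam_leP BM] : metric_bounded B.
  by apply: cf.2; apply/(metric_boundedP o); exists (4 * t + `|r|).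
have M0 := normr_ge0 M; have r0 := normr_ge0 r; have rr := ler_norm r.
have MM := ler_norm M.
(* The summand [t] transfers failure of chaining to scale [t], [|M|] bounds the link from [x] to
   [x'], and [|r|] keeps [f x'] in the ball. *)
pose s := t + `|M| + `|r|; have s0 : 0 < s by rewrite /s; lra.
have ts : t <= s by rewrite /s; lra.
have [x [x' [xx' nxx']]] := bad s0; exists x, x'; split=> //.
  move=> txx'; apply: nxx'; apply: chained_widen txx' => // z.
  by rewrite /mball /= => /le_trans; apply.
rewrite ltNge; apply/negP => ox; apply: nxx'.
have Bx : B x by rewrite /B /mball /=; lra.
have Bx' : B x'.
  rewrite /B /mball /=; apply: le_trans (metric_triangle _ (f x) _) _.
  by apply: lerD => //; exact: le_trans rr.
have xM := BM _ _ Bx Bx'.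
have xs : mdist x x' <= s by rewrite /s; lra.
exists 1%N, (fun i => if i is 0%N then x else x'); split=> //.
  case=> [|i] _; rewrite /mball /= ?mdistxx ?(ltW s0) //.
  by rewrite (le_trans xx') // /s; lra.
case=> // _; exists [set x; x']; last by split; [left|right].
apply/diam_leP; have x's := xs; rewrite metric_sym in x's.
by move=> _ _ [->|->] [->|->]; rewrite ?mdistxx ?(ltW s0).
Qed.

(** For [m < n] the growth conditions put the [t m]-ball about [f (x m)] inside the [t n]-ball about
    [o], and the [t n]-ball about [f (x n)] outside the ball of radius [3 * t n] about [o]. *)
Lemma bad_sequence : exists (t : nat -> R) (x x' : nat -> X), [/\
  forall n, [/\ 0 < t n, n%:R <= t n & 4 * t n < mdist o (f (x n))],
  forall m n, (m < n)%N -> mdist o (f (x m)) + t m <= t n,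
  forall n, mdist (f (x n)) (f (x' n)) <= r &
  forall n, ~ scale_chained f (t n) (x n) (x' n)].
Proof.
(* The pair for [t <= 0] is a dummy; only positive [t] occur in the sequence. *)
have /choice[p pP] (t : R) : exists p : X * X, 0 < t ->
    [/\ mdist (f p.1) (f p.2) <= r, ~ scale_chained f t p.1 p.2 &
        4 * t < mdist o (f p.1)].
  have [t0|t0] := pselect (0 < t); last by exists (x0, x0).
  by have [x [x' xx']] := far_bad_pair t0; exists (x, x').
pose G (t : R) := t + mdist o (f (p t).1) + 1.
pose t n := iter n G 1.
have tS n : t n.+1 = t n + mdist o (f (p (t n)).1) + 1 by [].
have t0 n : 0 < t n.
  elim: n => [|n IH]; first exact: ltr01.
  by rewrite tS ltr_wpDl ?ltr01 ?addr_ge0 ?mdist_ge0 ?(ltW IH).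
have tle m n : (m <= n)%N -> t m <= t n.
  elim: n => [|n IH]; first by rewrite leqn0 => /eqP ->.
  rewrite leq_eqVlt => /orP[/eqP ->//|/IH mn]; apply: le_trans mn _.
  by rewrite tS -addrA lerDl addr_ge0 ?mdist_ge0 ?ler01.
exists t, (fun n => (p (t n)).1), (fun n => (p (t n)).2); split.
- move=> n; split=> //; last by have [] := pP _ (t0 n).
  elim: n => [|n IH]; first by rewrite ler01.
  by rewrite tS -natr1 lerD2r (le_trans IH) // lerDl mdist_ge0.
- move=> m n /tle; apply: le_trans; rewrite tS.
  by rewrite [X in X + 1]addrC lerDl.
- by move=> n; have [] := pP _ (t0 n).
- by move=> n; have [] := pP _ (t0 n).
Qed.

Lemma disconnected_fibre : exists eta : higson_corona Y,
  ~ connected (higson_map cf @^-1` [set eta]).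
Proof.
have [t [x [x' [tP tlt xx' nxx']]]] := bad_sequence.
have t0 n : 0 < t n by have [] := tP n.
have tn n : n%:R <= t n by have [] := tP n.
have t4 n : 4 * t n < mdist o (f (x n)) by have [] := tP n.
pose ball_ n := mball (f (x n)) (t n).
have center n : ball_ n (f (x n)) by rewrite /ball_ /mball /= mdistxx ltW.
have far_lt m n y y' : (m < n)%N -> ball_ m y -> ball_ n y' ->
    t m < mdist y y' /\ t n < mdist y y'.
  rewrite /ball_ /mball /= => mn my ny'.
  have T1 := metric_triangle o (f (x m)) (f (x n)).
  have T2 := metric_triangle (f (x m)) y (f (x n)).
  have T3 := metric_triangle y y' (f (x n)).
  rewrite [mdist y' _]metric_sym in T3.
  have := tlt m n mn; have := t4 n; have := t0 n; have := t0 m.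
  have := mdist_ge0 o (f (x m)).
  by split; lra.
have far m n y y' : m <> n -> ball_ m y -> ball_ n y' -> t m < mdist y y'.
  move=> mn my ny'; case: (ltngtP m n) => // lt_mn.
    by have [] := far_lt _ _ _ _ lt_mn my ny'.
  by have [_] := far_lt _ _ _ _ lt_mn ny' my; rewrite metric_sym.
pose K n := [set z | chained [set U | (diam U <= (t n)%:E)%E]
  (f @^-1` ball_ n) (x n) z].
pose A := \bigcup_n K n; pose D := \bigcup_n ball_ n.
pose A' := f @^-1` D `\` A.
have Kball n z : K n z -> ball_ n (f z) by move=> c; have [] := chained_in c.
(* Since [t n] is at least [n], only finitely many balls have radius at most [s]. *)
have below (s : R) : exists2 M : R, 0 <= M &
    forall n y, t n <= s -> ball_ n y -> mdist o y <= M.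
  have [N sN] := exists_nat_gt s; exists (t N); first exact: ltW.
  move=> n y ns ny; have nN : (n < N)%N.
    by rewrite -(ltr_nat R); apply: le_lt_trans sN; exact: le_trans ns.
  apply: le_trans (tlt _ _ nN); apply: le_trans (metric_triangle _ (f (x n)) _) _.
  by rewrite lerD2l.
(* For [a] in [K m] and [a'] in [A'] at bounded distance, [t m] is bounded. Over different balls the
   images are more than [t m] apart; over the same ball a large [t m] would make [a], [a'] a link
   and put [a'] in [K m]. *)
have AA' : asymptotically_disjoint A A'.
  move=> q; pose q' := `|q| + `|q| + 1; have q0 := normr_ge0 q.
  have q'0 : 0 < q' by rewrite /q'; lra.
  have [s s0 fs] := ls_continuous_mdist cf.1 q'0.
  have [M M0 sM] := below (s + q').
  have : metric_bounded (thicken (f @^-1` mball o M) q).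
    by apply: thicken_bounded; apply: cf.2; apply/(metric_boundedP o); exists M.
  apply: metric_bounded_sub => z [[a [m _ Ka] az] [a' [[n _ na'] nAa'] a'z]].
  exists a => //; apply: (sM m); last exact: Kball.
  have aa' : mdist a a' <= q'.
    have := metric_triangle a z a'; rewrite [mdist z a']metric_sym.
    by have := ler_norm q; rewrite /q'; lra.
  have [mn|mn] := pselect (m = n); last first.
    have := far _ _ _ _ mn (Kball _ _ Ka) na'; have := fs _ _ aa'.
    by move=> h1 h2; lra.
  rewrite leNgt; apply/negP => big; apply: nAa'; exists m => //.
  apply: (chained_trans Ka); exists 1%N, (fun i => if i is 0%N then a else a').
  split=> //; first by case=> [|i] _; [exact: (Kball _ _ Ka)|rewrite /preimage /= mn].
  case=> // _; exists [set a; a']; last by split; [left|right].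
  have {}aa' : mdist a a' <= t m by lra.
  have a'a := aa'; rewrite metric_sym in a'a; apply/diam_leP.
  by move=> _ _ [->|->] [->|->]; rewrite ?mdistxx ?(ltW (t0 m)).
(* The function of this pair localises to [D]: it vanishes off [D] and is [1] at any limit of the
   centres at infinity. *)
have DE : asymptotically_disjoint (~` D) (range (f \o x)).
  move=> q; have [M M0 sM] := below (q + q).
  have : metric_bounded (thicken (mball o M) q).
    by apply: thicken_bounded; apply/(metric_boundedP o); exists M.
  apply: metric_bounded_sub => z [[e nDe ez] [_ [n _ <-] nz]].
  exists (f (x n)) => //; apply: (sM n); last exact: center.
  rewrite leNgt; apply/negP => big; apply: nDe; exists n => //.
  rewrite /ball_ /mball /=; have := metric_triangle (f (x n)) z e.
  by rewrite [mdist z e]metric_sym; move: nz => /=; lra.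
have [phi phiB [_ phi0 [B1 bB1 phi1]]] := Urysohn_Bh AA'.
have [psi psiB [_ psi0 [B2 bB2 psi1]]] := Urysohn_Bh DE.
pose Phi := MkBh phiB; pose Psi := MkBh psiB.
have [G [GU ooG]] := @ultraFilterLemma nat \oo _.
have GP : ProperFilter G by exact: ultra_proper.
have Gfx : at_infinity G (f \o x).
  move=> B /(metric_boundedP o)[M BM]; have [N MN] := exists_nat_gt M.
  apply: filterS (ooG _ (nbhs_infty_ge N)) => n /= Nn /BM oM.
  have Nn' : N%:R <= n%:R :> R by rewrite ler_nat.
  by have := t4 n; have := tn n; have := t0 n; lra.
have Gfx' : at_infinity G (f \o x') by exact: at_infinity_close xx' Gfx.
have at_inf (u : nat -> X) : at_infinity G (f \o u) -> at_infinity G u.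
  move=> Gu B /(image_bounded cf.1)/Gu; apply: filterS => n /= nB Bn.
  by apply: nB; exists (u n).
have [chi chiG] := ultra_character GU (at_inf x Gfx).
have [chi' chi'G] := ultra_character GU (at_inf x' Gfx').
pose eta := higson_map cf chi; exists eta.
(* The images of [x n] and [x' n] are within [r] of each other, so both limits lie over [eta]. *)
have chi'eta : higson_map cf chi' = eta.
  apply: corona_ext => g; rewrite /eta !ev_higson_map.
  apply: complex_cvg_unique (chi'G _) _.
  by apply: (Bh_cvg_close (u := f \o x) (v := f \o x') xx' Gfx); exact: chiG (Bh_pullback cf g).
have eta1 : ev eta Psi = 1.
  rewrite /eta ev_higson_map; apply: complex_cvg_unique (chiG _) _.
  apply: cvg_near_cst; apply: filterS (Gfx _ bB2) => n /= nB.
  by rewrite psi1 //; exists n.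
have chi0 : ev chi Phi = 0.
  apply: complex_cvg_unique (chiG _) _; apply: cvg_near_cst.
  apply: filterE => n /=; rewrite phi0 //; exists n => //.
  by apply: chained_refl; exact: center.
(* For [n > r] the point [x' n] lies over the [n]-th ball but in no [K m], hence in [A']. *)
have chi'1 : ev chi' Phi = 1.
  apply: complex_cvg_unique (chi'G _) _; apply: cvg_near_cst.
  have [N rN] := exists_nat_gt r.
  apply: filterS (filterI (at_inf x' Gfx' _ bB1) (ooG _ (nbhs_infty_ge N))).
  move=> n [/= nB Nn]; have Nn' : N%:R <= n%:R :> R by rewrite ler_nat.
  have bx' : ball_ n (f (x' n)).
    by rewrite /ball_ /mball /=; have := xx' n; have := tn n; lra.
  rewrite phi1 //; split; first by exists n.
  move=> [m _ Kx']; have [mn|mn] := pselect (m = n).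
    by apply: (nxx' n); rewrite -mn; rewrite -mn in Kx' *.
  have := far _ _ _ _ mn (Kball _ _ Kx') bx'; rewrite mdistxx.
  by have := t0 m; lra.
have dicho theta : higson_map cf theta = eta -> ev theta Phi = 0 \/ ev theta Phi = 1.
  move=> theta_eta.
  (* The product vanishes off [B1]: [Phi] is [0] on [A] and [1] on the rest of the preimage of [D],
     off which the last factor is [0]. That factor has value [1] at [theta]. *)
  have : ev theta (Phi * (1 - Phi) * Bh_pullback cf Psi) = 0.
    apply: ev_near_cst; apply: filterS (corona_filter_infty theta bB1) => z /= nB.
    rewrite -[LHS]/((phi z)%:C * (1 - (phi z)%:C) * (psi (f z))%:C).
    have [Dz|nDz] := pselect (D (f z)); last by rewrite psi0 // mulr0.
    have [Az|nAz] := pselect (A z); first by rewrite phi0 // !mul0r.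
    by rewrite phi1 // subrr mulr0 mul0r.
  rewrite !evM evB ev1 -ev_higson_map theta_eta eta1 mulr1 => /eqP.
  by rewrite mulf_eq0 subr_eq0 => /orP[/eqP ->|/eqP <-]; [left|right].
have ev_cont := @higson_eval_continuous R X (\pi_(higson_algebra X) Phi).
have closed_ev (c : R[i]^o) : closed [set theta : higson_corona X | ev theta Phi = c].
  apply: (proj1 (continuous_closedP _) ev_cont [set c]).
  by apply: accessible_closed_set1; apply: hausdorff_accessible; exact: norm_hausdorff.
move=> conn; pose Z := higson_map cf @^-1` [set eta].
(* On the fibre the zero set of the value at [Phi] is the complement of the set of value [1], hence
   clopen; it contains [chi] but not [chi']. *)
have /seteqP[_ ZB] : Z `&` [set theta | ev theta Phi = 0] = Z.
  apply: conn; first by exists chi.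
    exists (~` [set theta | ev theta Phi = 1]); first exact: closed_openC.
    apply/seteqP; split=> theta [Zt /= e0]; split=> //.
      by move=> /=; rewrite e0 => /esym/eqP; rewrite oner_eq0.
    by have [] := dicho theta Zt.
  by exists [set theta | ev theta Phi = 0].
have [_ /=] := ZB chi' chi'eta.
by rewrite chi'1 => /eqP; rewrite oner_eq0.
Qed.

End bad_pairs.

End monotone_to_light.

Theorem theorem8p7 (R : realType) (X Y : metricType R)
    (X_nonempty : inhabited X)
    (X_proper : proper_metric X) (Y_proper : proper_metric Y)
    (f : X -> Y) (f_coarse : coarse_map f) :
  coarsely_monotone f <-> monotone_map (higson_map f_coarse).
Proof.
have [x0] := X_nonempty; split.
  move=> /coarsely_monotoneP[fsurj fchain]; split.
  - exact: higson_map_continuous.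
  - exact: coarsely_surj_higson_map.
  - by move=> eta; exact: connected_fibre.
move=> [_ fsurj fconn]; apply/coarsely_monotoneP; split.
  exact: higson_map_surj_coarse x0 fsurj.
move=> r; apply: contrapT => nr.
have [|eta] := @disconnected_fibre R X Y f f_coarse x0 r; last exact.
move=> s s0; apply: contrapT => ns; apply: nr; exists s => // x x' xx'.
by apply: contrapT => nxx'; apply: ns; exists x, x'.
Qed.
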